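(* Let $d\ge 1$, let $\mathrm{E}:\mathbb{C}^{d\times d}\to\mathbb{R}$ be $\mathrm{E}(A)=\|AA^*-A^*A\|^2$, and let $\mathcal{F}:\mathbb{C}^{d\times d}\times[0,\infty)\to\mathbb{C}^{d\times d}$ be its negative gradient flow. For any $A_0\in\mathbb{C}^{d\times d}$, the limit $A_\infty=\lim_{t\to\infty}\mathcal{F}(A_0,t)$ exists, is a normal matrix, and has the same eigenvalues as $A_0$. Moreover, if $A_0$ has real entries, then so does $A_\infty$.
   Context: $\mathbb{C}^{d\times d}$ is regarded as a real inner product space with $\langle A,B\rangle=\mathrm{Re}\,\mathrm{tr}(B^*A)$; $\|\cdot\|$ is the Frobenius norm, $\|B\|^2=\sum_{i,j}|b_{ij}|^2$. A matrix $A$ is normal if $AA^*=A^*A$. The negative gradient flow $\mathcal{F}$ is defined by $\mathcal{F}(A_0,0)=A_0$ and $\frac{d}{dt}\mathcal{F}(A_0,t)=-\nabla\mathrm{E}(\mathcal{F}(A_0,t))$, where $\nabla$ is the gradient with respect to $\langle\cdot,\cdot\rangle$. Eigenvalues are listed with algebraic multiplicity, $\lambda_1,\dots,\lambda_d$. *)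

(* Defs.v *)
From HB Require Import structures.
From mathcomp Require Import all_boot all_order all_algebra.
From mathcomp Require Import all_classical all_reals all_analysis.
From mathcomp Require Import complex ring lra.

Set Implicit Arguments.
Unset Strict Implicit.
Unset Printing Implicit Defensive.

Import Order.TTheory GRing.Theory Num.Theory.
Import numFieldNormedType.Exports.
Local Open Scope classical_set_scope.
Local Open Scope ring_scope.
Local Open Scope complex_scope.
Local Open Scope sesquilinear_scope.

(* An alias of 'M[R[i]]_d: the latter is already a module over R[i] (with the
   entrywise maximum norm), whereas here the scalars are the reals and the norm
   is the Frobenius norm. *)
Definition cmat (R : realType) (d : nat) := 'M[R[i]]_d.

Section FrobeniusSpace.
Variables (R : realType) (d : nat).
Local Notation M := (cmat R d).
Implicit Types (A B C : M) (a b : R).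

HB.instance Definition _ := GRing.Zmodule.copy M 'M[R[i]]_d.

Definition rscale a A : M := (a%:C : R[i]) *: (A : 'M[R[i]]_d).

Fact rscaleA a b A : rscale a (rscale b A) = rscale (a * b) A.
Proof. by rewrite /rscale scalerA -rmorphM. Qed.

Fact rscale1 : left_id 1 rscale.
Proof. by move=> A; rewrite /rscale scale1r. Qed.

Fact rscaleDr : right_distributive rscale +%R.
Proof. by move=> a A B; rewrite /rscale scalerDr. Qed.

Fact rscaleDl A : {morph rscale^~ A : a b / a + b}.
Proof. by move=> a b; rewrite /rscale rmorphD scalerDl. Qed.

HB.instance Definition _ :=
  GRing.Zmodule_isLmodule.Build R M rscaleA rscale1 rscaleDr rscaleDl.

Definition inner A B : R :=
  complex.Re (\tr ((B : 'M[R[i]]_d) ^t* *m (A : 'M[R[i]]_d))).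

Definition frob A : R := Num.sqrt (\sum_i \sum_j Normc.normc (A i j) ^+ 2).

Lemma innerE A B : inner A B = \sum_i \sum_j
  (complex.Re (A i j) * complex.Re (B i j)
   + complex.Im (A i j) * complex.Im (B i j)).
Proof.
rewrite /inner /mxtrace raddf_sum /= exchange_big /=; apply: eq_bigr => j _.
rewrite mxE raddf_sum /=; apply: eq_bigr => i _; rewrite !mxE.
case: (A i j) => a b; case: (B i j) => u v /=.
by rewrite mulNr opprK mulrC [v * b]mulrC.
Qed.

Lemma frob_sqr A : frob A ^+ 2 = inner A A.
Proof.
rewrite /frob sqr_sqrtr; last first.
  by do 2 (apply: sumr_ge0 => ? _); exact: sqr_ge0.
rewrite innerE; apply: eq_bigr => i _; apply: eq_bigr => j _.
case: (A i j) => a b /=; rewrite sqr_sqrtr ?addr_ge0 ?sqr_ge0 //.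
Qed.

Lemma innerC A B : inner A B = inner B A.
Proof.
rewrite !innerE; apply: eq_bigr => i _; apply: eq_bigr => j _.
by rewrite mulrC [X in _ + X]mulrC.
Qed.

Lemma innerDl A B C : inner (A + B) C = inner A C + inner B C.
Proof. by rewrite /inner mulmxDr mxtraceD raddfD. Qed.

Lemma innerZl a A B : inner (a *: A) B = a * inner A B.
Proof.
rewrite !innerE mulr_sumr; apply: eq_bigr => i _.
rewrite mulr_sumr; apply: eq_bigr => j _; rewrite mxE.
by case: (A i j) => x y /=; rewrite !mul0r subr0 addr0 mulrDr !mulrA.
Qed.

Lemma inner_ge0 A : 0 <= inner A A.
Proof. by rewrite -frob_sqr sqr_ge0. Qed.

Lemma frob_ge0 A : 0 <= frob A. Proof. exact: sqrtr_ge0. Qed.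

Lemma frob_eq0 A : frob A = 0 -> A = 0.
Proof.
move=> A0; have : inner A A = 0 by rewrite -frob_sqr A0 expr0n.
have ge0 i j : 0 <= complex.Re (A i j) * complex.Re (A i j)
   + complex.Im (A i j) * complex.Im (A i j) by rewrite addr_ge0 ?sqr_ge0.
rewrite innerE => /eqP; rewrite psumr_eq0 => [/allP s0|i _]; last first.
  exact: sumr_ge0.
apply/matrixP => i j; have := s0 i (mem_index_enum _).
rewrite psumr_eq0 // => /allP/(_ j (mem_index_enum _)) /=.
rewrite paddr_eq0 ?sqr_ge0 // !mulf_eq0 !orbb mxE => /andP[/eqP r0 /eqP i0].
by move: r0 i0; case: (A i j) => x y /= -> ->.
Qed.

Lemma frobZ a A : frob (a *: A) = `|a| * frob A.
Proof.
apply/eqP; rewrite -(@eqrXn2 _ 2) ?mulr_ge0 ?frob_ge0 //.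
by rewrite exprMn !frob_sqr innerZl innerC innerZl mulrA real_normK ?num_real.
Qed.

Lemma inner_le A B : inner A B <= frob A * frob B.
Proof.
have [/eqP/frob_eq0 ->|B0] := boolP (frob B == 0).
  by rewrite -(scale0r (0 : M)) innerC innerZl mul0r mulr_ge0 ?frob_ge0.
have [/eqP/frob_eq0 ->|A0] := boolP (frob A == 0).
  by rewrite -(scale0r (0 : M)) innerZl mul0r mulr_ge0 ?frob_ge0.
have := inner_ge0 (frob B *: A + (- frob A) *: B).
rewrite innerDl !innerZl ![inner _ (_ + _)]innerC !innerDl !innerZl.
rewrite -!frob_sqr (innerC B A) => h.
have ab : 0 < frob A * frob B by rewrite mulr_gt0 // lt_def ?A0 ?B0 frob_ge0.
rewrite -subr_ge0 -(pmulr_rge0 _ ab) -(pmulr_rge0 _ (ltr0n _ 2)).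
by apply: le_trans h _; rewrite le_eqVlt; apply/orP; left; apply/eqP; ring.
Qed.

Lemma frobD A B : frob (A + B) <= frob A + frob B.
Proof.
rewrite -(@ler_pXn2r _ 2) ?nnegrE ?addr_ge0 ?frob_ge0 // sqrrD !frob_sqr.
rewrite innerDl ![inner _ (_ + _)]innerC !innerDl (innerC B A).
by have := inner_le A B; rewrite mulr2n; lra.
Qed.

HB.instance Definition _ := Lmodule_isNormed.Build R M frobD frobZ frob_eq0.

End FrobeniusSpace.

Section GradientFlow.
Variables (R : realType) (d : nat).
Local Notation M := (cmat R d).

(* G is the gradient of f at A for the real inner product [inner]. *)
Definition is_gradient (f : M -> R) (A G : M) : Prop :=
  differentiable f A /\ forall H : M, 'd f A H = inner G H.

Definition gradient (f : M -> R) (A : M) : M := xget 0 (is_gradient f A).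

(* The values of [F A0] at negative times are irrelevant: the difference
   quotient at t only involves times t + h >= 0, so that the derivative at
   t = 0 is the right derivative. *)
Definition is_negative_gradient_flow (f : M -> R) (F : M -> R -> M) : Prop :=
  forall A0 : M, F A0 0 = A0 /\
    forall t : R, 0 <= t ->
      h^-1 *: (F A0 (t + h) - F A0 t)
        @[h --> within [set h | 0 <= t + h] 0^'] --> - gradient f (F A0 t).

Definition energy (A : M) : R :=
  `| (A *m A ^t* - A ^t* *m A : M) | ^+ 2.

(* The eigenvalues listed with algebraic multiplicity, in some order. *)
Definition eigenvalues_of (A : M) (lambda : d.-tuple R[i]) : Prop :=
  char_poly A = \prod_(i < d) ('X - (tnth lambda i)%:P).

End GradientFlow.

(* Main.v *)
From HB Require Import structures.
Require Import Defs.
From mathcomp Require Import all_boot all_order all_algebra.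
From mathcomp Require Import all_classical all_reals all_analysis.
From mathcomp Require Import perm complex ring lra.

Import Order.TTheory GRing.Theory Num.Theory.
Import numFieldNormedType.Exports.
Local Open Scope classical_set_scope.
Local Open Scope ring_scope.
Set Implicit Arguments.
Unset Strict Implicit.
Unset Printing Implicit Defensive.

(** Write K = [A, A^*] for the defect of A. The gradient of E = |K|^2 is
    4 [K, A], so the flow A' = - 4 [K, A] = [- 4 K, A] is isospectral. Moreover
    (|A|^2)' = - 8 E, hence |A|^2 + 8 t E is nonincreasing and E tends to 0.

    Convergence rests on an explicit Lojasiewicz inequality, namely
    |K|^(3/2) <= C |[K, A]| for matrices A of given spectrum, bounded norm and
    small |K|. Let A = D + T be a triangular Schur form, D its diagonal, and let
    X_o be the part of X at the positions (i, j) with d_ii <> d_jj, which belong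
    to off-diagonal blocks for the eigenspaces of D. Then |T|^2 = O(|K|)
    (Henrici), |T_o| = O(|K_o|) and |K_o| = O(|[K, A]|), while
    |K|^2 = <A, [K, A]> <= |T| |[K, A]| + O(|T_o| |K_o|).

    Along the flow it gives |A'| <= - C (E^(1/4))', so that
    <A, U> + C |U| E^(1/4) is nonincreasing for every fixed matrix U. *)

(** * Commutators and the Frobenius norm *)

(** Locked so that commutators stay opaque during unification; they are opened only through
    [bracketE]. *)
HB.lock Definition bracket (R : realType) (d : nat) (A B : cmat R d) : cmat R d :=
  ((A : 'M[R[i]]_d) *m B - (B : 'M[R[i]]_d) *m A)%R.

Section Algebra.
Variables (R : realType) (d : nat).
Local Notation M := (cmat R d).
Local Notation normc := Normc.normc.
Implicit Types (A B C H K X Y : M).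

(** Product and adjoint are retyped in [cmat], so that norms and scalars around them are read as the
    Frobenius norm and real scalars. *)
Definition mul A B : M := (A : 'M[R[i]]_d) *m B.
Definition adj A : M := map_mx Num.conj (A : 'M[R[i]]_d)^T.
Definition defect A : M := bracket A (adj A).

Lemma bracketE A B : bracket A B = mul A B - mul B A.
Proof. by rewrite unlock. Qed.

Lemma mulE A B i j : mul A B i j = \sum_k A i k * B k j.
Proof. by rewrite mxE. Qed.

Lemma adjE A i j : adj A i j = (A j i)^*%C.
Proof. by rewrite !mxE. Qed.

Lemma addE A B i j : (A + B) i j = A i j + B i j. Proof. by rewrite mxE. Qed.
Lemma oppE A i j : (- A) i j = - A i j. Proof. by rewrite mxE. Qed.
Lemma scaleE (a : R) A i j : (a *: A) i j = a%:C%C * A i j.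
Proof. by rewrite mxE. Qed.

Lemma cmat_normE A : `|A| = frob A. Proof. by []. Qed.

Lemma cmulDl A B C : mul (A + B) C = mul A C + mul B C.
Proof. exact: mulmxDl. Qed.
Lemma cmulDr A B C : mul A (B + C) = mul A B + mul A C.
Proof. exact: mulmxDr. Qed.
Lemma cmulNl A B : mul (- A) B = - mul A B. Proof. exact: mulNmx. Qed.
Lemma cmulNr A B : mul A (- B) = - mul A B. Proof. exact: mulmxN. Qed.
Lemma cmulZl (a : R) A B : mul (a *: A) B = a *: mul A B.
Proof. by rewrite /mul -scalemxAl. Qed.
Lemma cmulZr (a : R) A B : mul A (a *: B) = a *: mul A B.
Proof. by rewrite /mul -scalemxAr. Qed.
Lemma mul_assoc A B C : mul A (mul B C) = mul (mul A B) C.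
Proof. exact: mulmxA. Qed.

Lemma adjD A B : adj (A + B) = adj A + adj B.
Proof. by apply/matrixP => i j; rewrite !(adjE, addE) rmorphD. Qed.
Lemma adjN A : adj (- A) = - adj A.
Proof. by apply/matrixP => i j; rewrite !(adjE, oppE) rmorphN. Qed.
Lemma adjK A : adj (adj A) = A.
Proof. by apply/matrixP => i j; rewrite !adjE conjcK. Qed.
Lemma adjM A B : adj (mul A B) = mul (adj B) (adj A).
Proof.
apply/matrixP => i j; rewrite adjE !mulE rmorph_sum.
by apply: eq_bigr => k _; rewrite rmorphM mulrC !adjE.
Qed.

Lemma bracketDl A B C : bracket (A + B) C = bracket A C + bracket B C.
Proof. by rewrite !bracketE cmulDl cmulDr opprD addrACA. Qed.
Lemma bracketNl A B : bracket (- A) B = - bracket A B.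
Proof. by rewrite !bracketE cmulNl cmulNr -opprD. Qed.
Lemma bracketN A B : bracket A B = - bracket B A.
Proof. by rewrite !bracketE opprB. Qed.
Lemma bracketDr A B C : bracket A (B + C) = bracket A B + bracket A C.
Proof. by rewrite bracketN bracketDl opprD -!bracketN. Qed.
Lemma bracketNr A B : bracket A (- B) = - bracket A B.
Proof. by rewrite bracketN bracketNl -bracketN. Qed.

Lemma adj_bracket A B : adj (bracket A B) = bracket (adj B) (adj A).
Proof. by rewrite !bracketE adjD adjN !adjM. Qed.
Lemma adj_defect A : adj (defect A) = defect A.
Proof. by rewrite /defect adj_bracket adjK. Qed.

Lemma energyE A : energy A = `|defect A| ^+ 2.
Proof. by rewrite /defect bracketE. Qed.

Lemma normcE (z : R[i]) : normc z ^+ 2 = complex.Re z ^+ 2 + complex.Im z ^+ 2.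
Proof. by case: z => a b /=; rewrite sqr_sqrtr ?addr_ge0 ?sqr_ge0. Qed.

Lemma normc_ge0 (z : R[i]) : 0 <= normc z.
Proof. by case: z => a b; exact: sqrtr_ge0. Qed.

Lemma normc_conj (z : R[i]) : normc z^*%C = normc z.
Proof. by case: z => a b; rewrite /= sqrrN. Qed.

Lemma sqr_norm_entries A : `|A| ^+ 2 = \sum_i \sum_j normc (A i j) ^+ 2.
Proof.
rewrite cmat_normE frob_sqr innerE.
by do 2 (apply: eq_bigr => ? _); rewrite normcE -!expr2.
Qed.

Lemma sqr_norm A : `|A| ^+ 2 = inner A A.
Proof. exact: frob_sqr. Qed.

Lemma entry_le_norm A i j : normc (A i j) <= `|A|.
Proof.
rewrite -(@ler_pXn2r _ 2) ?nnegrE ?normc_ge0 // sqr_norm_entries.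
rewrite (bigD1 i) //= (bigD1 j) //= -addrA lerDl addr_ge0 //.
  by apply: sumr_ge0 => ? _; rewrite sqr_ge0.
by do 2 (apply: sumr_ge0 => ? _); rewrite sqr_ge0.
Qed.

Lemma norm_le_entries (c : R) A B : 0 <= c ->
  (forall i j, normc (A i j) <= c * normc (B i j)) -> `|A| <= c * `|B|.
Proof.
move=> c0 AB; rewrite -(@ler_pXn2r _ 2) ?nnegrE ?mulr_ge0 //.
rewrite exprMn !sqr_norm_entries mulr_sumr ler_sum // => i _.
rewrite mulr_sumr ler_sum // => j _.
by rewrite -exprMn lerXn2r ?nnegrE ?mulr_ge0 ?normc_ge0.
Qed.

Lemma norm_adj A : `|adj A| = `|A|.
Proof.
apply/eqP; rewrite -(@eqrXn2 _ 2) // !sqr_norm_entries exchange_big /=.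
apply/eqP; apply: eq_bigr => i _; apply: eq_bigr => j _.
by rewrite adjE normc_conj.
Qed.

Lemma innerNl A B : inner (- A) B = - inner A B.
Proof. by rewrite /inner mulmxN !raddfN. Qed.

Lemma real_cauchy_schwarz (a b : 'I_d -> R) :
  (\sum_k a k * b k) ^+ 2 <= (\sum_k a k ^+ 2) * (\sum_k b k ^+ 2).
Proof.
(* Placing the vectors on diagonals reduces the claim to Cauchy-Schwarz for [inner]. *)
pose D (u : 'I_d -> R) : M := \matrix_(i, j) ((if i == j then u i else 0)%:C)%C.
have DE (u v : 'I_d -> R) : inner (D u) (D v) = \sum_k u k * v k.
  rewrite innerE; apply: eq_bigr => i _.
  rewrite (bigD1 i) //= big1 => [|j ji]; rewrite !mxE; last first.
    by rewrite eq_sym (negbTE ji) /= !mul0r addr0.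
  by rewrite eqxx /= mul0r !addr0.
have sq (u : 'I_d -> R) : \sum_k u k ^+ 2 = `|D u| ^+ 2.
  by rewrite sqr_norm DE; apply: eq_bigr => k _; rewrite expr2.
rewrite !sq -exprMn -DE -real_normK ?num_real //.
rewrite lerXn2r ?nnegrE ?mulr_ge0 // ler_norml inner_le andbT lerNl.
by rewrite -innerNl -(normrN (D a)) inner_le.
Qed.

(** Cauchy-Schwarz for the moduli along row i of A and column j of B bounds the (i, j) entry of the
    product. *)
Lemma norm_mul A B : `|mul A B| <= `|A| * `|B|.
Proof.
rewrite -(@ler_pXn2r _ 2) ?nnegrE ?mulr_ge0 // exprMn !sqr_norm_entries.
rewrite mulr_suml ler_sum // => i _; rewrite [X in _ * X]exchange_big /=.
rewrite mulr_sumr ler_sum // => j _.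
apply: le_trans (real_cauchy_schwarz _ _); rewrite mulE.
rewrite lerXn2r ?nnegrE ?normc_ge0 //.
  by apply: sumr_ge0 => k _; rewrite mulr_ge0 ?normc_ge0.
elim/big_rec2: _ => [|k x y _ xy]; first by rewrite Normc.normc0.
by apply: le_trans (le_normcD _ _) _; rewrite Normc.normcM lerD2l.
Qed.

Lemma norm_bracket A B : `|bracket A B| <= 2 * `|A| * `|B|.
Proof.
have := ler_normB (mul A B) (mul B A); rewrite -bracketE.
by have := norm_mul A B; have := norm_mul B A; lra.
Qed.

Lemma inner_le_norm A B : inner A B <= `|A| * `|B|.
Proof. exact: inner_le. Qed.

Lemma inner_norm A B : `|inner A B| <= `|A| * `|B|.
Proof.
rewrite ler_norml inner_le andbT lerNl -innerNl.
by rewrite -(normrN A) inner_le.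
Qed.

Lemma innerDr A B C : inner A (B + C) = inner A B + inner A C.
Proof. by rewrite ![inner A _]innerC innerDl. Qed.
Lemma innerZr (a : R) A B : inner A (a *: B) = a * inner A B.
Proof. by rewrite ![inner A _]innerC innerZl. Qed.
Lemma innerNr A B : inner A (- B) = - inner A B.
Proof. by rewrite ![inner A _]innerC innerNl. Qed.

Lemma inner_adj A B : inner (adj A) (adj B) = inner A B.
Proof.
rewrite !innerE exchange_big /=; do 2 (apply: eq_bigr => ? _).
by rewrite !adjE; case: (A _ _) => a b; case: (B _ _) => u v /=; rewrite mulrNN.
Qed.

Lemma inner_trace A B : inner A B = complex.Re (\tr (mul (adj B) A)).
Proof. by []. Qed.

Lemma inner_mulr A B C : inner (mul A B) C = inner A (mul C (adj B)).
Proof.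
by rewrite !inner_trace adjM adjK -mul_assoc mul_assoc [in LHS]/mul mxtrace_mulC.
Qed.

Lemma inner_mull A B C : inner (mul A B) C = inner B (mul (adj A) C).
Proof. by rewrite !inner_trace adjM adjK mul_assoc. Qed.

(** The maps H -> [H, A^*] and K -> [K, A] are adjoint to each other; the gradient formula and the
    Henrici estimate both rest on this. *)
Lemma inner_bracket_adj H A K :
  inner (bracket H (adj A)) K = inner H (bracket K A).
Proof.
by rewrite !bracketE innerDl innerNl inner_mulr inner_mull adjK innerDr innerNr.
Qed.

(* Hence a critical point of the energy is normal. *)
Lemma sqr_norm_defect A : `|defect A| ^+ 2 = inner A (bracket (defect A) A).
Proof. by rewrite sqr_norm {1}/defect inner_bracket_adj. Qed.

End Algebra.

(** * The Lojasiewicz inequality *)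

(** The estimates are combined here as inequalities between real numbers: t = |T|, k = |K|, g =
    |[K, A]|, o = |K_o|, p = |T_o|, a = |A|, and c is the Henrici constant. *)
Lemma lojasiewicz_arith (R : rcfType) (gap b c t k g o p a : R) :
  0 < gap -> 0 <= t -> 0 <= k -> 0 <= g -> 0 <= o -> 0 <= p -> 0 <= a ->
  0 <= c -> a <= b -> o <= k ->
  k ^+ 2 <= t * g + 2 * a * p * o ->
  gap * o <= g + 2 * o * t + 2 * k * p ->
  gap * p <= o + 4 * t * p ->
  t ^+ 2 <= c * k ->
  k <= 1 -> k <= gap ^+ 2 / 16 -> k <= gap ^+ 2 / (64 * (c + 1)) ->
  Num.sqrt k ^+ 3 <= (Num.sqrt c + 8 * b / gap ^+ 2) * g.
Proof.
move=> g0 t0 k0 gr0 o0 p0 a0 c0 ab ok kE gE oE tE k1 kg kc.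
set s := Num.sqrt k; have s0 : 0 <= s by exact: sqrtr_ge0.
have sk : s ^+ 2 = k by rewrite sqr_sqrtr.
have s1 : s <= 1 by rewrite -(@ler_pXn2r _ 2) ?nnegrE // sk expr1n.
have ks : k <= s by rewrite -sk expr2 ler_piMr.
have tg : t <= gap / 8.
  rewrite -(@ler_pXn2r _ 2) ?nnegrE ?divr_ge0 // ?(ltW g0) //.
  apply: le_trans tE _; move: kc; rewrite ler_pdivlMr; last by lra.
  by rewrite expr_div_n => kc; nra.
have ts : t <= Num.sqrt c * s.
  by rewrite -sqrtrM // -[t]ger0_norm // -sqrtr_sqr ler_wsqrtr.
(* Since 4 t <= gap / 2, the term 4 t p is absorbed by the left side; the terms in o are absorbed
   likewise in the next step. *)
have po : gap * p <= 2 * o by nra.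
have og : gap * o <= 2 * g.
  have : k * p <= gap / 8 * o.
    rewrite -(ler_pM2l g0) mulrCA.
    apply: le_trans (ler_wpM2l k0 po) _.
    have := ler_wpM2r o0 kg; rewrite expr2; lra.
  by nra.
(* In p o, the factor p is bounded through o <= k <= s and the factor o through g, which yields one
   power of s = k^(1/2) besides g. *)
have pog : gap ^+ 2 * (p * o) <= 4 * (s * g).
  have -> : gap ^+ 2 * (p * o) = (gap * p) * (gap * o) by ring.
  have -> : 4 * (s * g) = (2 * s) * (2 * g) by ring.
  by apply: ler_pM => //; rewrite ?mulr_ge0 // ?(ltW g0) //; lra.
set C := Num.sqrt c + _.
have k2 : k ^+ 2 <= C * g * s.
  have tgs : t * g <= Num.sqrt c * g * s by rewrite mulrAC ler_wpM2r.
  have : 2 * a * p * o <= 8 * b / gap ^+ 2 * g * s.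
    have -> : 8 * b / gap ^+ 2 * g * s = 2 * b * ((4 * (s * g)) / gap ^+ 2).
      by field; lra.
    rewrite -mulrA ler_pM ?mulr_ge0 //; first by lra.
    by rewrite ler_pdivlMr ?exprn_gt0 // mulrC.
  by rewrite /C 2!mulrDl; lra.
(* It remains to divide k^2 = s^4 <= C g s by s. *)
have [s0'|s0'] := eqVneq s 0.
  rewrite s0' expr0n mulr_ge0 // addr_ge0 ?sqrtr_ge0 //.
  by rewrite divr_ge0 ?exprn_ge0 ?mulr_ge0 ?(ltW g0) //; lra.
have sp : 0 < s by rewrite lt_def s0'.
rewrite -(ler_pM2r sp); apply: le_trans k2.
by rewrite -sk -exprM -exprSr.
Qed.

Section Lojasiewicz.
Variables (R : realType) (d : nat).
Local Notation M := (cmat R d).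
Local Notation normc := Normc.normc.
Implicit Types (A B X Y : M) (mu : 'I_d -> R[i]).

(** The part X_o for the partition of the indices by the value of [mu]; the blocks need not be
    contiguous. *)
Definition offblock mu X : M :=
  \matrix_(i, j) (if mu i == mu j then 0 else X i j).

Lemma offblockE mu X i j :
  offblock mu X i j = if mu i == mu j then 0 else X i j.
Proof. by rewrite mxE. Qed.

Lemma offblockD mu X Y : offblock mu (X + Y) = offblock mu X + offblock mu Y.
Proof.
apply/matrixP => i j; rewrite addE !offblockE addE.
by case: ifP; rewrite ?addr0.
Qed.

Lemma adj_offblock mu X : adj (offblock mu X) = offblock mu (adj X).
Proof.
apply/matrixP => i j; rewrite adjE !offblockE adjE eq_sym.
by case: ifP; rewrite ?rmorph0.
Qed.

Lemma norm_offblock mu X : `|offblock mu X| <= `|X|.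
Proof.
rewrite -[leRHS]mul1r norm_le_entries // => i j.
by rewrite offblockE mul1r; case: ifP; rewrite ?Normc.normc0 ?normc_ge0.
Qed.

Lemma norm_onblock mu X : `|X - offblock mu X| <= `|X|.
Proof.
rewrite -[leRHS]mul1r norm_le_entries // => i j; rewrite mul1r.
rewrite addE oppE offblockE.
by case: ifP; rewrite ?subr0 ?subrr ?Normc.normc0 ?normc_ge0.
Qed.

Lemma inner_offblock mu X Y :
  inner (offblock mu X) Y = inner (offblock mu X) (offblock mu Y).
Proof.
rewrite !innerE; do 2 (apply: eq_bigr => ? _); rewrite !offblockE.
by case: ifP => //=; rewrite !mul0r.
Qed.

(* Block diagonal matrices form a subalgebra. *)
Lemma offblock_bracket_onblock mu X Y :
  offblock mu (bracket (X - offblock mu X) (Y - offblock mu Y)) = 0.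
Proof.
have mul0 Z W : offblock mu (mul (Z - offblock mu Z) (W - offblock mu W)) = 0.
  apply/matrixP => i j; rewrite offblockE [RHS]mxE; case: eqP => // /eqP ij.
  rewrite mulE big1 // => k _; rewrite !addE !oppE !offblockE.
  case: eqP => [ik|_]; last by rewrite subrr mul0r.
  by rewrite -ik (negbTE ij) subrr mulr0.
apply/matrixP => i j; rewrite offblockE [RHS]mxE; case: ifP => // ij.
have := mul0 X Y; move=> /matrixP/(_ i j); rewrite offblockE ij [RHS]mxE => XY.
have := mul0 Y X; move=> /matrixP/(_ i j); rewrite offblockE ij [RHS]mxE => YX.
by rewrite bracketE addE oppE XY YX subr0.
Qed.

(** Split X and Y into their parts on and off the blocks: the bracket of the two on-block parts
    drops out, and every other term carries an off-block factor. *)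
Lemma norm_offblock_bracket mu X Y : `|offblock mu (bracket X Y)| <=
  2 * `|offblock mu X| * `|Y| + 2 * `|X| * `|offblock mu Y|.
Proof.
set Xo := offblock mu X; set Yo := offblock mu Y.
have -> : bracket X Y = bracket Xo Y + bracket (X - Xo) Yo
    + bracket (X - Xo) (Y - Yo).
  by rewrite -addrA -bracketDr [Yo + _]addrC subrK -bracketDl addrC subrK.
rewrite 2!offblockD (offblock_bracket_onblock mu X Y) addr0.
apply: le_trans (ler_normD _ _) _; apply: lerD.
  exact: le_trans (norm_offblock _ _) (norm_bracket _ _).
apply: le_trans (norm_offblock _ _) _; apply: le_trans (norm_bracket _ _) _.
by rewrite ler_wpM2r // ler_wpM2l // norm_onblock.
Qed.

Definition diagonal A : M := \matrix_(i, j) (if i == j then A i i else 0).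

Lemma diagonalE A i j : diagonal A i j = if i == j then A i i else 0.
Proof. by rewrite mxE. Qed.

Lemma norm_diagonal A : `|diagonal A| <= `|A|.
Proof.
rewrite -[leRHS]mul1r norm_le_entries // => i j; rewrite diagonalE mul1r.
by case: eqP => [->|_]; rewrite ?Normc.normc0 ?normc_ge0.
Qed.

Lemma mul_diagonall A X i j : mul (diagonal A) X i j = A i i * X i j.
Proof.
rewrite mulE (bigD1 i) //= big1 ?addr0 => [|k ki].
  by rewrite diagonalE eqxx.
by rewrite diagonalE eq_sym (negbTE ki) mul0r.
Qed.

Lemma mul_diagonalr A X i j : mul X (diagonal A) i j = X i j * A j j.
Proof.
rewrite mulE (bigD1 j) //= big1 ?addr0 => [|k kj].
  by rewrite diagonalE eqxx.
by rewrite diagonalE (negbTE kj) mulr0.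
Qed.

Lemma adj_diagonal A : adj (diagonal A) = diagonal (adj A).
Proof.
apply/matrixP => i j; rewrite adjE !diagonalE eq_sym adjE.
by case: eqP => [->|_]; rewrite ?rmorph0.
Qed.

(** Bracketing with a diagonal matrix multiplies entries by differences of eigenvalues, so off the
    blocks it can be inverted at the cost of 1 / gap. *)
Lemma bracket_diagonal A X i j :
  bracket X (diagonal A) i j = X i j * (A j j - A i i).
Proof.
rewrite bracketE addE oppE mul_diagonall mul_diagonalr mulrBr.
by rewrite [A i i * _]mulrC.
Qed.

Lemma bracket_diagonal_adj A : bracket (diagonal A) (adj (diagonal A)) = 0.
Proof.
apply/matrixP => i j; rewrite adj_diagonal bracket_diagonal diagonalE [RHS]mxE.
by case: eqP => [->|_]; rewrite ?subrr ?mulr0 ?mul0r.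
Qed.

(** * Lower triangular matrices whose distinct diagonal entries are at least [gap] apart *)

Section Triangular.
Variables (A : M) (gap : R).
Hypothesis trigA : forall i j : 'I_d, (i < j)%N -> A i j = 0.
Hypothesis gap0 : 0 < gap.
Hypothesis gapA : forall i j, A i i != A j j -> gap <= normc (A j j - A i i).

Let D := diagonal A.
Let T := A - D.
Let K := defect A.
Let G := bracket K A.
Let off := offblock (fun i => A i i).

Let TE i j : T i j = if (j < i)%N then A i j else 0.
Proof.
rewrite addE oppE diagonalE; case: (ltngtP j i) => [ji|ij|/val_inj->].
- by rewrite ifN ?subr0 // neq_ltn ji orbT.
- by rewrite ifN ?subr0 ?trigA // neq_ltn ij.
- by rewrite eqxx subrr.
Qed.

(* Testing K against the diagonal matrix of weights w_i = i gives the sum of the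
   (w_i - w_j) |a_ij|^2, where w_i - w_j >= 1 below the diagonal. *)
Lemma henrici_triangular :
  `|T| ^+ 2 <= `|(\matrix_(i, j) (if i == j then (i%:R%:C)%C else 0) : M)| * `|K|.
Proof.
set W := (\matrix_(i, j) _ : M).
have WE i j : W i j = if i == j then (i%:R%:C)%C else 0 by rewrite mxE.
apply: le_trans (inner_le_norm _ _).
have -> : inner W K = inner A (bracket W A).
  by rewrite innerC /K /defect inner_bracket_adj.
have BE i j : bracket W A i j = (((i%:R - j%:R) : R)%:C)%C * A i j.
  rewrite bracketE addE oppE !mulE (bigD1 i) //= big1 => [|k ki]; last first.
    by rewrite WE eq_sym (negbTE ki) mul0r.
  rewrite (bigD1 j) //= big1 => [|k kj]; last first.
    by rewrite WE (negbTE kj) mulr0.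
  by rewrite !WE !eqxx !addr0 rmorphB mulrBl [A i j * _]mulrC.
rewrite sqr_norm_entries innerE ler_sum // => i _; rewrite ler_sum // => j _.
rewrite BE TE normcE; case: ifP => [ji|/negbT]; last first.
  rewrite -leqNgt leq_eqVlt => /predU1P[/val_inj->|/trigA->].
    by rewrite subrr mul0r /= !mulr0 !expr0n /= !addr0.
  by rewrite mulr0 /= !mulr0 !expr0n /= !addr0.
have : (1 : R) <= i%:R - j%:R.
  by rewrite lerBrDl natr1 ler_nat.
case: (A i j) => a b /=; rewrite !mul0r subr0 addr0.
have := sqr_ge0 a; have := sqr_ge0 b; rewrite !expr2.
by set u := i%:R - j%:R => *; nra.
Qed.

Let AE : A = D + T. Proof. by rewrite /T addrC subrK. Qed.

Let offD : off D = 0.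
Proof.
apply/matrixP => i j; rewrite offblockE diagonalE [RHS]mxE; case: ifP => //.
by case: (eqVneq i j) => [->|//]; rewrite eqxx.
Qed.

(** As D is normal, K = [T, D^*] + [D, T^*] + [T, T^*]. Below the diagonal the linear part is
    [T, D^*] alone, which multiplies t_ij by a conjugated difference of eigenvalues; the quadratic
    term gives 4 |T| |T_o|. *)
Lemma offblock_triangular : gap * `|off T| <= `|off K| + 4 * `|T| * `|off T|.
Proof.
have KE : K = bracket T (adj D) + bracket D (adj T) + bracket T (adj T).
  rewrite /K /defect [in LHS]AE adjD bracketDl !bracketDr.
  by rewrite bracket_diagonal_adj add0r addrCA addrA.
set L := bracket T (adj D) + bracket D (adj T).
have TL : gap * `|off T| <= `|off L|.
  rewrite -[leRHS]mul1r -ler_pdivlMl // mul1r norm_le_entries ?invr_ge0 ?ltW //.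
  move=> i j; rewrite ler_pdivlMl // !offblockE.
  case: ifPn => [|ij]; first by rewrite Normc.normc0 mulr0.
  rewrite TE; case: ifPn => [ji|]; last first.
    by rewrite Normc.normc0 mulr0 normc_ge0.
  (* [D, T^*] is strictly upper triangular, hence zero at positions with j < i. *)
  rewrite addE [bracket D _ i j](_ : _ = 0) ?addr0.
    rewrite adj_diagonal bracket_diagonal !adjE -rmorphB Normc.normcM normc_conj.
    by rewrite TE ji mulrC ler_wpM2l ?normc_ge0 // gapA.
  rewrite bracketN oppE bracket_diagonal adjE TE ifN ?rmorph0 ?mul0r ?oppr0 //.
  by rewrite -leqNgt ltnW.
apply: le_trans TL _.
have -> : off L = off K - off (bracket T (adj T)).
  by rewrite KE /off [in RHS]offblockD addrK.
apply: le_trans (ler_normB _ _) _; rewrite lerD2l.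
apply: le_trans (norm_offblock_bracket _ _ _) _.
rewrite -adj_offblock !norm_adj -/(off T).
by rewrite le_eqVlt; apply/orP; left; apply/eqP; ring.
Qed.

(** [K, D] = [K, A] - [K, T], and [K, D] multiplies each off-block entry of K by a number of modulus
    at least [gap]. *)
Lemma offblock_gradient : gap * `|off K| <=
  `|G| + 2 * `|off K| * `|T| + 2 * `|K| * `|off T|.
Proof.
have KD : gap * `|off K| <= `|off (bracket K D)|.
  rewrite -[leRHS]mul1r -ler_pdivlMl // mul1r norm_le_entries ?invr_ge0 ?ltW //.
  move=> i j; rewrite ler_pdivlMl // !offblockE.
  case: ifPn => [|ij]; first by rewrite Normc.normc0 mulr0.
  by rewrite bracket_diagonal Normc.normcM mulrC ler_wpM2l ?normc_ge0 // gapA.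
apply: le_trans KD _.
have -> : off (bracket K D) = off G - off (bracket K T).
  by rewrite /G [in RHS]AE bracketDr /off offblockD addrK.
apply: le_trans (ler_normB _ _) _; rewrite -addrA lerD ?norm_offblock //.
exact: norm_offblock_bracket.
Qed.

(** In |K|^2 = <D, [K, A]> + <T, [K, A]> the first term equals <[D, T^*], K> by duality and
    normality of D. Since [D, T^*] vanishes on the blocks, it only sees K_o. *)
Lemma sqr_defect_triangular :
  `|K| ^+ 2 <= `|T| * `|G| + 2 * `|A| * `|off T| * `|off K|.
Proof.
rewrite sqr_norm_defect -/K -/G [in X in inner X _]AE innerDl addrC.
rewrite lerD ?inner_le_norm //.
have -> : inner D G = inner (off (bracket D (adj T))) K.
  rewrite /G -inner_bracket_adj [in adj _]AE adjD bracketDr bracket_diagonal_adj.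
  rewrite add0r; congr inner; apply/matrixP => i j; rewrite offblockE.
  case: ifPn => // /eqP ij; rewrite bracketN oppE bracket_diagonal ij subrr.
  by rewrite mulr0 oppr0.
rewrite /off inner_offblock -/off; apply: le_trans (inner_le_norm _ _) _.
rewrite ler_wpM2r //; apply: le_trans (norm_offblock_bracket _ _ _) _.
rewrite -adj_offblock -/off offD normr0 mulr0 mul0r add0r.
by rewrite norm_adj ler_wpM2r // ler_wpM2l // norm_diagonal.
Qed.

End Triangular.

Definition weights : M := \matrix_(i, j) (if i == j then (i%:R%:C)%C else 0).

(* The exponent 3/2 < 2 is what makes the flow lines have finite length. *)
Lemma lojasiewicz_triangular (b gap : R) : 0 < gap -> 0 <= b ->
  exists e C : R, [/\ 0 < e, 0 <= C & forall A : M,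
    (forall i j : 'I_d, (i < j)%N -> A i j = 0) ->
    (forall i j, A i i != A j j -> gap <= normc (A j j - A i i)) ->
    `|A| <= b -> `|defect A| <= e ->
    Num.sqrt `|defect A| ^+ 3 <= C * `|bracket (defect A) A|].
Proof.
move=> g0 b0; set c := `|weights|.
(* The minimum collects the three smallness conditions of [lojasiewicz_arith]; c + 1 is positive
   even if [weights] is zero. *)
exists (Num.min 1 (Num.min (gap ^+ 2 / 16) (gap ^+ 2 / (64 * (c + 1))))).
exists (Num.sqrt c + 8 * b / gap ^+ 2).
have c0 : 0 <= c by exact: normr_ge0.
have g20 : 0 < gap ^+ 2 by rewrite exprn_gt0.
split.
- by rewrite !lt_min ltr01 !divr_gt0 //; lra.
- by rewrite addr_ge0 ?sqrtr_ge0 // divr_ge0 ?mulr_ge0 // ltW.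
move=> A trigA gapA Ab; rewrite !le_min => /and3P[K1 Kg Kc].
apply: (lojasiewicz_arith g0 _ _ _ _ _ _ c0 Ab _
  (sqr_defect_triangular A) (offblock_gradient g0 gapA)
  (offblock_triangular trigA g0 gapA) (henrici_triangular trigA)) => //.
exact: norm_offblock.
Qed.

(** * Reduction to the triangular case by unitary conjugation *)

Lemma norm_conj_unitary (P A : M) : mul P (adj P) = 1%:M ->
  `|mul (mul P A) (adj P)| = `|A|.
Proof.
move=> PP; have PP' : mul (adj P) P = 1%:M by exact: mulmx1C.
apply/eqP; rewrite -(@eqrXn2 _ 2) // !sqr_norm; apply/eqP.
rewrite inner_mulr adjK -mul_assoc PP' [mul _ 1%:M]mulmx1.
by rewrite inner_mull mul_assoc PP' [mul 1%:M _]mul1mx.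
Qed.

Lemma bracket_conj_unitary (P A B : M) : mul P (adj P) = 1%:M ->
  bracket (mul (mul P A) (adj P)) (mul (mul P B) (adj P)) =
  mul (mul P (bracket A B)) (adj P).
Proof.
move=> PP; have PP' : mul (adj P) P = 1%:M by exact: mulmx1C.
have PM X Y : mul (mul (mul P X) (adj P)) (mul (mul P Y) (adj P)) =
    mul (mul P (mul X Y)) (adj P).
  rewrite -!mul_assoc; congr mul; congr mul.
  by rewrite mul_assoc PP' [mul 1%:M _]mul1mx.
by rewrite !bracketE !PM cmulDr cmulNr cmulDl cmulNl.
Qed.

Lemma defect_conj_unitary (P A : M) : mul P (adj P) = 1%:M ->
  defect (mul (mul P A) (adj P)) = mul (mul P (defect A)) (adj P).
Proof.
move=> PP; rewrite /defect -bracket_conj_unitary //.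
by rewrite !adjM adjK mul_assoc.
Qed.

(** The gap depends on the spectrum alone, so the constants built from it are uniform along an
    isospectral flow. *)
Lemma root_gap (n : nat) (l : n.-tuple R[i]) : exists2 gap : R, 0 < gap &
  forall i j, tnth l i != tnth l j -> gap <= normc (tnth l j - tnth l i).
Proof.
pose D (ij : 'I_n * 'I_n) := normc (tnth l ij.2 - tnth l ij.1).
(* The default value 1 serves when all the entries coincide. *)
exists (\big[Num.min/1]_(ij | tnth l ij.1 != tnth l ij.2) D ij).
  elim/big_ind: _ => [//|x y x0 y0|[i j] /= ij]; first by rewrite lt_min x0.
  rewrite lt_def normc_ge0 andbT; apply: contraNneq ij => /Normc.eq0_normc.
  by move/eqP; rewrite subr_eq0 eq_sym.
by move=> i j ij; exact: (@bigmin_le_cond _ _ _ _ (i, j)).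
Qed.

Lemma char_poly_eval (A : M) (x : R[i]) :
  (char_poly (A : 'M[R[i]]_d)).[x] = \det (x%:M - (A : 'M[R[i]]_d)).
Proof.
rewrite /char_poly -[LHS]/(horner_eval x _) -det_map_mx; congr (\det _).
apply/matrixP => i j; rewrite !mxE /= /horner_eval !hornerE.
by rewrite hornerMn hornerX.
Qed.

(** A nonzero difference p of the two polynomials would vanish at the [size p] distinct numbers 0,
    1, 2, ..., more than its degree allows. *)
Lemma char_poly_eq (A B : M) :
  (forall x : R[i], \det (x%:M - (A : 'M[R[i]]_d)) = \det (x%:M - (B : 'M[R[i]]_d))) ->
  char_poly (A : 'M[R[i]]_d) = char_poly (B : 'M[R[i]]_d).
Proof.
move=> AB; apply/eqP; rewrite -subr_eq0; apply: contraT => nz.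
pose p := char_poly (A : 'M[R[i]]_d) - char_poly (B : 'M[R[i]]_d).
have := @max_poly_roots _ p (map (fun k : nat => k%:R) (iota 0 (size p))) nz.
rewrite size_map size_iota ltnn => -> //.
  by apply/allP => x _; rewrite rootE hornerD hornerN !char_poly_eval AB subrr.
rewrite map_inj_uniq ?iota_uniq // => m n /eqP.
by rewrite eqr_nat => /eqP.
Qed.

(** A Schur form B of A is lower triangular with diagonal entries among the eigenvalues, and unitary
    conjugation preserves the norms of A, of its defect and of their bracket. *)
Lemma lojasiewicz (b : R) (l : d.-tuple R[i]) : (0 < d)%N -> 0 <= b ->
  exists e C : R, [/\ 0 < e, 0 <= C & forall A : M,
    eigenvalues_of A l -> `|A| <= b -> `|defect A| <= e ->
    Num.sqrt `|defect A| ^+ 3 <= C * `|bracket (defect A) A|].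
Proof.
move=> d0 b0; have [gap gap0 gapl] := root_gap l.
have [e [C [e0 C0 loj]]] := lojasiewicz_triangular gap0 b0.
exists e, C; split=> // A Al Ab Ae.
have [P Pu PA] := Schur (A : 'M[R[i]]_d) d0.
have PP : mul P (adj P) = 1%:M by exact/unitarymxP.
pose B := mul (mul P A) (adj P).
have trigB : is_trig_mx (B : 'M[R[i]]_d) by move: PA; rewrite /similar_to conjymx.
have charB : char_poly (B : 'M[R[i]]_d) = char_poly (A : 'M[R[i]]_d).
  apply: char_poly_eq => x.
  have -> : x%:M - (B : 'M[R[i]]_d) = P *m (x%:M - (A : 'M[R[i]]_d)) *m adj P.
    rewrite mulmxBr mulmxBl mul_mx_scalar -scalemxAl [P *m adj P]PP.
    by rewrite scalemx1.
  rewrite !det_mulmx mulrAC -det_mulmx [P *m adj P]PP det1 mul1r.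
  by [].
have rootB i : exists j, B i i = tnth l j.
  have : root (char_poly (B : 'M[R[i]]_d)) (B i i).
    rewrite char_poly_trig // rootE horner_prod (bigD1 i) //=.
    by rewrite hornerXsubC subrr mul0r.
  rewrite charB Al rootE horner_prod => /prodf_eq0[j _].
  by rewrite hornerXsubC subr_eq0 => /eqP; exists j.
have /is_trig_mxP trigB' := trigB.
have := loj B trigB'.
rewrite /B defect_conj_unitary // bracket_conj_unitary // !norm_conj_unitary //.
apply=> // i j; have [k Bi] := rootB i; have [m Bj] := rootB j.
by rewrite -/B Bi Bj; exact: gapl.
Qed.
End Lojasiewicz.

(** * The gradient of the energy *)

Section Calculus.
Variables (R : realType) (d : nat).
Local Notation M := (cmat R d).
Implicit Types (A B G H X : M) (f : M -> R).

Lemma inner_is_linear G : linear (inner G : M -> R^o).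
Proof. by move=> a A B; rewrite innerDr innerZr. Qed.

(** A first-order expansion with quadratic remainder on the unit ball identifies the differential;
    the functions below are all differentiated this way. *)
Lemma diff_quadratic f A G (C : R) : 0 <= C ->
  (forall H, `|H| <= 1 -> `|f (A + H) - f A - inner G H| <= C * `|H| ^+ 2) ->
  differentiable f A /\ forall H, 'd f A H = inner G H.
Proof.
move=> C0 fA.
pose lM := GRing.isLinear.Build _ _ _ _ _ (inner_is_linear G).
pose df : {linear M -> R^o} := HB.pack (inner G : M -> R^o) lM.
have dfc : continuous df.
  apply: bounded_linear_continuous; apply/ex_bound; exists `|G|.
  near=> H; apply: le_trans (inner_norm _ _) _.
  by rewrite ler_piMr //; near: H; exact: nbhs0_le.
have fE : f \o shift A = cst (f A) + df +o_ (0 : M) id.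
  apply/eqaddoP => _ /posnumP[e]; near=> H => /=.
  rewrite -[X in `|X|]/(f (H + A) - (f A + inner G H)) opprD addrA addrC.
  have H1 : `|H| <= 1 by near: H; exact: nbhs0_le.
  have He : C * `|H| <= e%:num.
    apply: le_trans (_ : (C + 1) * `|H| <= _).
      by rewrite ler_wpM2r // lerDl.
    rewrite -ler_pdivlMl ?ltr_wpDl // mulrC.
    by near: H; apply: nbhs0_le; rewrite divr_gt0 // ltr_wpDl.
  rewrite addrC [H + A]addrC; apply: le_trans (fA _ H1) _.
  by rewrite expr2 mulrA ler_wpM2r.
have dE := diff_unique dfc fE.
split; last by move=> H; rewrite dE.
by apply/diff_locallyP; rewrite dE.
Unshelve. all: by end_near. Qed.

Lemma is_derive_comp_curve f (u : R -> M) (t : R) (V G : M) :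
  is_derive t 1 u V -> differentiable f (u t) ->
  (forall H, 'd f (u t) H = inner G H) -> is_derive t 1 (f \o u) (inner G V).
Proof.
move=> [/derivable1_diffP du uV] df dfE.
have dc : differentiable (f \o u) t by exact: differentiable_comp.
split; first exact/derivable1_diffP.
rewrite deriveE; last exact: dc.
by rewrite (diff_comp du df) /= dfE -(deriveE _ du) uV.
Qed.

Lemma defectD A H : defect (A + H) =
  defect A + ((bracket A (adj H) + bracket H (adj A)) + defect H).
Proof. by rewrite /defect adjD bracketDl !bracketDr !addrA. Qed.

Lemma sqr_normD A B : `|A + B| ^+ 2 = `|A| ^+ 2 + 2 * inner A B + `|B| ^+ 2.
Proof.
by rewrite !sqr_norm innerDl 2!innerDr (innerC B A) mulr_natl mulr2n !addrA.
Qed.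

(** The defect at A + H is K + L + Q with L linear in H and Q = [defect H]. The two halves of L are
    adjoint to each other and K is Hermitian, so 2 <K, L> = 4 <H, [K, A]>; what remains, 2 <K, Q> +
    |L + Q|^2, is of second order. *)
Lemma energy_expansion A H : `|H| <= 1 ->
  `|energy (A + H) - energy A - inner (4 *: bracket (defect A) A) H| <=
  (4 * `|defect A| + (4 * `|A| + 2) ^+ 2) * `|H| ^+ 2.
Proof.
move=> H1; rewrite !energyE defectD.
set K := defect A; set L := bracket A _ + bracket H _; set Q := defect H.
have LK : inner L K = 2 * inner H (bracket K A).
  rewrite /L innerDl -[inner (bracket A _) _]inner_adj adj_bracket adjK.
  by rewrite [adj K]adj_defect inner_bracket_adj mulr2n mulrDl mul1r.
have nQ : `|Q| <= 2 * `|H| ^+ 2.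
  by apply: le_trans (norm_bracket _ _) _; rewrite norm_adj -mulrA.
have nL : `|L| <= 4 * `|A| * `|H|.
  apply: le_trans (ler_normD _ _) _.
  have := norm_bracket A (adj H); have := norm_bracket H (adj A).
  by rewrite !norm_adj; lra.
have -> : `|K + (L + Q)| ^+ 2 - `|K| ^+ 2 - inner (4 *: bracket K A) H =
    2 * inner K Q + `|L + Q| ^+ 2.
  rewrite sqr_normD innerDr (innerC K L) LK innerZl (innerC (bracket K A)).
  by ring.
apply: le_trans (ler_normD _ _) _; rewrite normrM (ger0_norm (ler0n R 2)).
rewrite (ger0_norm (sqr_ge0 _)).
have H0 := normr_ge0 H; have K0 := normr_ge0 K.
have nKQ : `|inner K Q| <= 2 * `|K| * `|H| ^+ 2.
  apply: le_trans (inner_norm _ _) _; apply: le_trans (ler_wpM2l K0 nQ) _.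
  by lra.
have nLQ : `|L + Q| <= (4 * `|A| + 2) * `|H|.
  apply: le_trans (ler_normD _ _) _; apply: le_trans (lerD nL nQ) _.
  have : `|H| ^+ 2 <= `|H| by rewrite expr2 ler_piMr.
  by lra.
have nLQ2 : `|L + Q| ^+ 2 <= (4 * `|A| + 2) ^+ 2 * `|H| ^+ 2.
  by rewrite -exprMn lerXn2r ?nnegrE ?mulr_ge0 ?addr_ge0 ?mulr_ge0.
by rewrite [leRHS]mulrDl; apply: lerD => //; lra.
Qed.

Lemma diff_energy A : differentiable (@energy R d) A /\
  forall H, 'd (@energy R d) A H = inner (4 *: bracket (defect A) A) H.
Proof.
apply: diff_quadratic (@energy_expansion A).
by rewrite addr_ge0 ?mulr_ge0 ?sqr_ge0.
Qed.

Lemma gradient_energy A : gradient (@energy R d) A = 4 *: bracket (defect A) A.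
Proof.
have [dE dEE] := diff_energy A.
(* The choice in [gradient] is determined: two vectors representing the same differential differ by
   a vector orthogonal to itself. *)
rewrite /gradient; apply: xget_unique => // G [_ GE].
apply/eqP; rewrite -subr_eq0 -normr_eq0 -sqrf_eq0 sqr_norm innerDl innerNl.
by rewrite -GE -dEE subrr.
Qed.

Lemma diff_sqr_norm A : differentiable (fun X : M => `|X| ^+ 2) A /\
  forall H, 'd (fun X : M => `|X| ^+ 2) A H = inner (2 *: A) H.
Proof.
apply: (@diff_quadratic _ _ _ 1) => // H _.
rewrite sqr_normD innerZl mul1r [X in `|X|](_ : _ = `|H| ^+ 2); last by ring.
by rewrite ger0_norm ?sqr_ge0.
Qed.

(** * Complex conjugation and the distance to real matrices *)

Definition cconj A : M := map_mx Num.conj (A : 'M[R[i]]_d).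

Lemma cconjE A i j : cconj A i j = (A i j)^*%C.
Proof. by rewrite mxE. Qed.

Lemma cconjD A B : cconj (A + B) = cconj A + cconj B.
Proof. by apply/matrixP => i j; rewrite addE !cconjE addE rmorphD. Qed.

Lemma cconjN A : cconj (- A) = - cconj A.
Proof. by apply/matrixP => i j; rewrite oppE !cconjE oppE rmorphN. Qed.

Lemma cconjK A : cconj (cconj A) = A.
Proof. by apply/matrixP => i j; rewrite !cconjE conjcK. Qed.

Lemma cconjM A B : cconj (mul A B) = mul (cconj A) (cconj B).
Proof. exact: map_mxM. Qed.

Lemma cconj_bracket A B : cconj (bracket A B) = bracket (cconj A) (cconj B).
Proof. by rewrite !bracketE cconjD cconjN !cconjM. Qed.

Lemma cconj_defect A : cconj (defect A) = defect (cconj A).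
Proof.
rewrite /defect cconj_bracket; congr bracket.
by apply/matrixP => i j; rewrite !(cconjE, adjE).
Qed.

Lemma norm_cconj A : `|cconj A| = `|A|.
Proof.
apply/eqP; rewrite -(@eqrXn2 _ 2) // !sqr_norm_entries; apply/eqP.
by do 2 (apply: eq_bigr => ? _); rewrite cconjE normc_conj.
Qed.

Lemma inner_cconj A B : inner (cconj A) B = inner A (cconj B).
Proof.
rewrite !innerE; do 2 (apply: eq_bigr => ? _); rewrite !cconjE.
by case: (A _ _) => a b; case: (B _ _) => u v /=; rewrite mulNr mulrN.
Qed.

(** Y = A - cconj A satisfies cconj Y = - Y, so pairing Y with H - cconj H doubles its pairing with
    H; hence the factor 4. *)
Lemma diff_sqr_imaginary A : differentiable (fun X : M => `|X - cconj X| ^+ 2) A /\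
  forall H, 'd (fun X : M => `|X - cconj X| ^+ 2) A H =
    inner (4 *: (A - cconj A)) H.
Proof.
apply: (@diff_quadratic _ _ _ 4) => // H _.
have -> : A + H - cconj (A + H) = (A - cconj A) + (H - cconj H).
  by rewrite cconjD opprD addrACA.
set Y := A - cconj A.
have YH : inner Y (H - cconj H) = 2 * inner Y H.
  have cY : cconj Y = - Y by rewrite /Y cconjD cconjN cconjK opprB addrC.
  by rewrite innerDr innerNr -inner_cconj cY innerNl opprK mulr_natl mulr2n.
rewrite sqr_normD YH innerZl.
rewrite [X in `|X|](_ : _ = `|H - cconj H| ^+ 2); last by ring.
rewrite ger0_norm ?sqr_ge0 //.
have : `|H - cconj H| <= 2 * `|H|.
  by apply: le_trans (ler_normB _ _) _; rewrite norm_cconj; lra.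
move=> H2; have -> : 4 * `|H| ^+ 2 = (2 * `|H|) ^+ 2 by ring.
by rewrite lerXn2r ?nnegrE ?mulr_ge0.
Qed.

End Calculus.

(** * Flow lines *)

Section Flow.
Variables (R : realType) (d : nat).
Local Notation M := (cmat R d).
Implicit Types (f : M -> R) (u : R -> M).

(* A flow line is continued affinely to negative times, so that it becomes
   differentiable in the ordinary sense at 0. *)
Lemma flow_line f (F : M -> R -> M) (A0 : M) : is_negative_gradient_flow f F ->
  exists u, (forall t, 0 <= t -> u t = F A0 t) /\
    (forall t : R, 0 <= t -> is_derive t 1 u (- gradient f (u t))).
Proof.
move=> /(_ A0)[F0 dF]; pose V := - gradient f (F A0 0).
pose u t := if 0 <= t then F A0 t else A0 + t *: V.
have uE t : 0 <= t -> u t = F A0 t by rewrite /u => ->.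
exists u; split=> // t t0.
suff du : h^-1 *: ((u \o shift t) (h *: (1 : R^o)) - u t) @[h --> 0^']
    --> - gradient f (u t).
  split; first by apply/cvg_ex; exists (- gradient f (u t)).
  exact: cvg_lim du.
move=> U; rewrite uE // => VU.
have nU : \forall h \near (0 : R)^',
  0 <= t + h -> U (h^-1 *: (F A0 (t + h) - F A0 t)) := dF t t0 _ VU.
suff : \forall h \near (0 : R)^',
  U (h^-1 *: ((u \o shift t) (h *: (1 : R^o)) - F A0 t)) by [].
have [t00|tn0] := eqVneq t 0; near=> h;
  have hE : h *: (1 : R^o) + t = t + h by rewrite addrC [_ *: _]mulr1.
  rewrite /= hE /u; case: ifPn => [th|_]; first by move: th; near: h.
  have h0 : h != 0 by near: h; exact: nbhs_dnbhs_neq.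
  rewrite t00 add0r F0 addrAC subrr add0r scalerA mulVf // scale1r.
  by apply: nbhs_singleton; rewrite /V -t00.
have th : 0 <= t + h.
  have : `|h| < t by near: h; apply: dnbhs0_lt; rewrite lt_def tn0.
  by rewrite ltr_norml; lra.
by rewrite /= hE uE //; move: th; near: h.
Unshelve. all: by end_near. Qed.

Lemma decreasing_of_derive (g g' : R -> R) (a : R) :
  (forall t, a <= t -> is_derive t 1 g (g' t)) ->
  (forall t, a <= t -> g' t <= 0) ->
  forall s t, a <= s -> s <= t -> g t <= g s.
Proof.
move=> dg g0 s t as_ st.
have [||c] := @MVT_segment R g g' s t st.
- move=> x; rewrite in_itv /= => /andP[sx _].
  by apply: dg; rewrite (le_trans as_) // ltW.
- apply: derivable_within_continuous => x; rewrite in_itv /= => /andP[sx _].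
  by have [] := dg x (le_trans as_ sx).
rewrite in_itv /= => /andP[sc _] gE; rewrite -subr_le0 gE.
by rewrite mulr_le0_ge0 ?subr_ge0 // g0 // (le_trans as_).
Qed.

Lemma decreasing_cvg (g : R -> R) (a b : R) :
  (forall s t, a <= s -> s <= t -> g t <= g s) ->
  (forall t, a <= t -> b <= g t) -> exists l : R, g t @[t --> +oo] --> l.
Proof.
(* Freezing g before time a makes it monotone on the whole line; the sign makes it nondecreasing. *)
move=> dg gb; pose k t := - g (Num.max a t).
have amax t : a <= Num.max a t by rewrite le_max lexx.
have : k t @[t --> +oo] --> sup (range k).
  apply: nondecreasing_cvgr => [s t st|]; first last.
    by exists (- b) => _ [t _ <-]; rewrite lerN2 gb.
  by rewrite lerN2 dg // ge_max !le_max lexx st orbT.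
move=> kl; exists (- sup (range k)).
have : (- k t) @[t --> +oo] --> - sup (range k) by exact: cvgN.
apply: cvg_trans; apply: near_eq_cvg; near=> t.
rewrite /k opprK max_r //; near: t; exact: nbhs_pinfty_ge.
Unshelve. all: by end_near. Qed.

End Flow.

(** * A priori estimates along a flow line *)

Section Dynamics.
Variables (R : realType) (d : nat).
Local Notation M := (cmat R d).
Implicit Types (A B X : M).

Definition velocity X : M := - (4 *: bracket (defect X) X).

Lemma norm_velocity X : `|velocity X| = 4 * `|bracket (defect X) X|.
Proof. by rewrite normrN normrZ ger0_norm. Qed.

Lemma cconj_velocity X : cconj (velocity X) = velocity (cconj X).
Proof.
have cZ (a : R) A : cconj (a *: A) = a *: cconj A.
  apply/matrixP => i j; rewrite cconjE !scaleE cconjE; case: (A i j) => x y /=.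
  by apply/eqP; rewrite eq_complex /= !mul0r !subr0 !addr0 mulrN !eqxx.
by rewrite cconjN cZ cconj_bracket cconj_defect.
Qed.

Lemma bracket_lipschitz (A B X Y : M) : `|bracket A X - bracket B Y| <=
  2 * `|A - B| * `|X| + 2 * `|B| * `|X - Y|.
Proof.
have -> : bracket A X - bracket B Y = bracket (A - B) X + bracket B (X - Y).
  by rewrite bracketDl bracketDr bracketNl bracketNr addrA subrK.
by apply: le_trans (ler_normD _ _) _; apply: lerD; exact: norm_bracket.
Qed.

(** The bracket estimate is applied twice: it gives 4 b for the defect, then (8 + 4) b^2 for [K, A],
    and the velocity carries a further factor 4. *)
Lemma velocity_lipschitz (b : R) A B : `|A| <= b -> `|B| <= b ->
  `|velocity A - velocity B| <= 48 * b ^+ 2 * `|A - B|.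
Proof.
move=> Ab Bb; have A0 := normr_ge0 A; have AB0 := normr_ge0 (A - B).
have b0 : 0 <= b := le_trans A0 Ab.
have dAB : `|defect A - defect B| <= 4 * b * `|A - B|.
  apply: le_trans (bracket_lipschitz _ _ _ _) _.
  rewrite norm_adj -adjN -adjD norm_adj.
  have := ler_wpM2l AB0 Ab; have := ler_wpM2l AB0 Bb; lra.
have dB : `|defect B| <= 2 * b ^+ 2.
  apply: le_trans (norm_bracket _ _) _; rewrite norm_adj -mulrA ler_wpM2l //.
  by rewrite expr2 ler_pM.
rewrite /velocity -opprD normrN -scalerBr normrZ ger0_norm //.
have : `|bracket (defect A) A - bracket (defect B) B| <= 12 * b ^+ 2 * `|A - B|.
  apply: le_trans (bracket_lipschitz _ _ _ _) _.
  have -> : 12 * b ^+ 2 * `|A - B| =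
    2 * (4 * b * `|A - B|) * b + 2 * (2 * b ^+ 2) * `|A - B| by ring.
  apply: lerD; last by rewrite ler_wpM2r // ler_wpM2l.
  by rewrite ler_pM ?mulr_ge0 // ler_wpM2l.
by lra.
Qed.

Variable u : R -> M.
Hypothesis du : forall t : R, 0 <= t -> is_derive t 1 u (velocity (u t)).

Lemma derive_sqr_norm (t : R) : 0 <= t ->
  is_derive t 1 (fun t : R => `|u t| ^+ 2) (- (8 * energy (u t))).
Proof.
move=> t0; have [dN dNE] := diff_sqr_norm (u t).
have := is_derive_comp_curve (du t0) dN dNE.
rewrite /velocity innerNr innerZl innerZr -sqr_norm_defect -energyE.
by rewrite mulrA -natrM.
Qed.

Lemma derive_energy (t : R) : 0 <= t -> is_derive t 1 (fun t : R => energy (u t))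
  (- (16 * `|bracket (defect (u t)) (u t)| ^+ 2)).
Proof.
move=> t0; have [dE dEE] := diff_energy (u t).
have := is_derive_comp_curve (du t0) dE dEE.
by rewrite /velocity innerNr innerZl innerZr -sqr_norm mulrA -natrM.
Qed.

Lemma energy_decreasing (s t : R) : 0 <= s -> s <= t -> energy (u t) <= energy (u s).
Proof.
apply: (decreasing_of_derive derive_energy) => {}t _.
by rewrite oppr_le0 mulr_ge0 ?sqr_ge0.
Qed.

Lemma norm_decreasing (t : R) : 0 <= t -> `|u t| <= `|u 0|.
Proof.
move=> t0; rewrite -(@ler_pXn2r _ 2) ?nnegrE //.
apply: (decreasing_of_derive derive_sqr_norm) => // s _.
by rewrite oppr_le0 mulr_ge0 // energyE sqr_ge0.
Qed.

Lemma energy_decay (t : R) : 0 <= t -> 8 * t * energy (u t) <= `|u 0| ^+ 2.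
Proof.
move=> t0; pose g (t : R) := `|u t| ^+ 2 + 8 * t * energy (u t).
(* The terms - 8 E and 8 E cancel, leaving 8 s E'. *)
have dg (s : R) : 0 <= s -> is_derive s 1 g
    (- (8 * s * (16 * `|bracket (defect (u s)) (u s)| ^+ 2))).
  move=> s0; have d1 := derive_sqr_norm s0; have d2 := derive_energy s0.
  apply: is_derive_eq; rewrite [8%:A]mulr1 /GRing.scale /=.
  by move: (energy _) (`|_| ^+ 2) => x y; ring.
have : g t <= g 0.
  apply: (decreasing_of_derive dg) => // s s0.
  by rewrite oppr_le0 !mulr_ge0 ?sqr_ge0.
rewrite /g mulr0 mul0r addr0; apply: le_trans.
by rewrite lerDr sqr_ge0.
Qed.

Lemma energy_small (e : R) : 0 < e -> exists a : R,
  0 <= a /\ forall t : R, a <= t -> energy (u t) <= e.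
Proof.
move=> e0; set q := `|u 0| ^+ 2 / (8 * e).
have q0 : 0 <= q by rewrite divr_ge0 ?sqr_ge0 // mulr_ge0 // ltW.
exists (q + 1); split=> [|t qt]; first by rewrite addr_ge0.
have t0 : 0 < t by lra.
have := energy_decay (ltW t0) => h.
have : `|u 0| ^+ 2 <= t * (8 * e) by rewrite -ler_pdivrMr ?mulr_gt0 // -/q; lra.
by move=> /(le_trans h) {}h; rewrite -(ler_pM2l t0); lra.
Qed.

(** A Gronwall argument: the velocity commutes with conjugation and is Lipschitz on the ball of
    radius b, so y = |u - cconj u|^2 satisfies y' <= 96 b^2 y with y(0) = 0. *)
Lemma flow_real : u 0 = cconj (u 0) -> forall t : R, 0 <= t -> u t = cconj (u t).
Proof.
move=> u0 t t0; set b := `|u 0|.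
pose y (s : R) := `|u s - cconj (u s)| ^+ 2.
pose g (s : R) := y s * expR (- (96 * b ^+ 2) * s).
pose w (s : R) := inner (4 *: (u s - cconj (u s))) (velocity (u s)).
have dy (s : R) : 0 <= s -> is_derive s 1 y (w s).
  move=> s0; have [dI dIE] := diff_sqr_imaginary (u s).
  exact: is_derive_comp_curve (du s0) dI dIE.
have wy (s : R) : 0 <= s -> w s <= 96 * b ^+ 2 * y s.
  move=> s0; rewrite /w innerZl; set Y := u s - _; set W := velocity _.
  have cY : cconj Y = - Y by rewrite cconjD cconjN cconjK opprB addrC.
  have YW : 2 * inner Y W = inner Y (W - cconj W).
    by rewrite innerDr innerNr -inner_cconj cY innerNl opprK mulr_natl mulr2n.
  have : inner Y (W - cconj W) <= 48 * b ^+ 2 * y s.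
    apply: le_trans (inner_le_norm _ _) _.
    rewrite cconj_velocity /y expr2 mulrCA ler_wpM2l // velocity_lipschitz //.
      exact: norm_decreasing.
    by rewrite norm_cconj norm_decreasing.
  by lra.
have dg (s : R) : 0 <= s -> is_derive s 1 g
    ((w s - 96 * b ^+ 2 * y s) * expR (- (96 * b ^+ 2) * s)).
  move=> s0; have d1 := dy s s0; set c := - (96 * b ^+ 2).
  have d2 : is_derive s 1 (fun s : R => expR (c * s)) (c * expR (c * s)).
    apply: is_derive_eq; rewrite [_ *: _]mulr1 /GRing.scale /=.
    by rewrite mulrC.
  apply: is_derive_eq; rewrite /GRing.scale /= /c.
  by move: (y s) (w s) (expR _) => x z v; ring.
have : g t <= g 0.
  apply: (decreasing_of_derive dg) => // s s0.
  by rewrite mulr_le0_ge0 ?expR_ge0 // subr_le0 wy.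
rewrite /g /y {1}u0 subrr normr0 expr0n mul0r.
rewrite pmulr_lle0 ?expR_gt0 // => yt.
apply/eqP; rewrite -subr_eq0 -normr_eq0 -sqrf_eq0 eq_le yt sqr_ge0.
by [].
Qed.

End Dynamics.

(** * Isospectrality *)

Section CharPoly.
Variables (R : realType) (d : nat).
Local Notation M := (cmat R d).
Local Notation normc := Normc.normc.
Implicit Types (A B X : M).

Definition cdet A : R[i] := \det (A : 'M[R[i]]_d).

Lemma cdetM A B : cdet (mul A B) = cdet A * cdet B.
Proof. exact: det_mulmx. Qed.

Lemma cdet1 : cdet 1%:M = 1.
Proof. exact: det1. Qed.

Lemma normc_prod (I : Type) (s : seq I) (a : I -> R[i]) (m : R) :
  (forall i, normc (a i) <= m) -> normc (\prod_(i <- s) a i) <= m ^+ size s.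
Proof.
move=> am; elim: s => [|i s IH]; first by rewrite big_nil Normc.normc1.
by rewrite big_cons Normc.normcM exprS ler_pM ?normc_ge0.
Qed.

(** The factors are exchanged one at a time, by aP - bQ = (a - b)P + b(P - Q); 1 <= m makes the
    powers of m increasing. *)
Lemma prod_lipschitz (I : Type) (s : seq I) (a b : I -> R[i]) (m e : R) :
  1 <= m -> (forall i, normc (a i) <= m) -> (forall i, normc (b i) <= m) ->
  (forall i, normc (a i - b i) <= e) ->
  normc (\prod_(i <- s) a i - \prod_(i <- s) b i) <=
    (size s)%:R * m ^+ size s * e.
Proof.
move=> m1 am bm ab; elim: s => [|i s IH].
  by rewrite !big_nil subrr Normc.normc0 !mul0r.
have e0 : 0 <= e := le_trans (normc_ge0 _) (ab i).
have m0 : 0 <= m by apply: le_trans m1.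
rewrite !big_cons; set P := \prod_(j <- s) a j; set Q := \prod_(j <- s) b j.
have -> : a i * P - b i * Q = (a i - b i) * P + b i * (P - Q) by ring.
apply: le_trans (le_normcD _ _) _; rewrite !Normc.normcM /=.
have -> : (size s).+1%:R * m ^+ (size s).+1 * e =
   e * m ^+ (size s).+1 + m * ((size s)%:R * m ^+ size s * e).
  by rewrite -natr1 exprS; ring.
apply: lerD; last by rewrite ler_pM ?normc_ge0.
rewrite ler_pM ?normc_ge0 //; apply: le_trans (normc_prod _ am) _.
by rewrite exprS ler_peMl ?exprn_ge0.
Qed.

Lemma normc_sum (I : finType) (a : I -> R[i]) :
  normc (\sum_i a i) <= \sum_i normc (a i).
Proof.
elim/big_rec2: _ => [|i x y _ yx]; first by rewrite Normc.normc0.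
by apply: le_trans (le_normcD _ _) _; rewrite lerD2l.
Qed.

Lemma cdet_lipschitz (m : R) : 1 <= m -> exists2 C : R, 0 <= C &
  forall A B, `|A| <= m -> `|B| <= m -> normc (cdet A - cdet B) <= C * `|A - B|.
Proof.
move=> m1; have m0 : 0 <= m by apply: le_trans m1.
exists (\sum_(s : 'S_d) d%:R * m ^+ d) => [|A B Am Bm].
  by apply: sumr_ge0 => s _; rewrite mulr_ge0 ?exprn_ge0.
rewrite /cdet /determinant -sumrB; apply: le_trans (normc_sum _) _.
rewrite mulr_suml ler_sum // => s _; rewrite -mulrBr Normc.normcM.
have -> : normc ((-1) ^+ s : R[i]) = 1.
  by case: (odd_perm s); rewrite ?expr1 ?expr0 ?normcN Normc.normc1.
rewrite mul1r.
have := @prod_lipschitz _ (index_enum 'I_d) (fun i => A i (s i))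
  (fun i => B i (s i)) m `|A - B| m1.
rewrite [size _](_ : _ = d); last by rewrite /index_enum unlock -enumT size_enum_ord.
apply=> i; first exact: le_trans (entry_le_norm _ _ _) Am.
  exact: le_trans (entry_le_norm _ _ _) Bm.
by have := entry_le_norm (A - B) i (s i); rewrite addE oppE.
Qed.

(* (x - A')(1 + hB) - (1 + hB)(x - A) = h[B, A] - (A' - A) - h(A' - A)B, where
   both products have determinants with the common factor det (1 + hB). *)
Lemma cdet_perturbation (A B : M) (x : R[i]) : exists2 C : R, 0 <= C &
  forall (h : R) (A' : M), `|h| <= 1 -> `|A' - A| <= 1 -> C * `|h| <= 2^-1 ->
    normc (cdet (x%:M - A') - cdet (x%:M - A)) <=
      C * (`|A' - A - h *: bracket B A| + `|h| * `|A' - A|).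
Proof.
pose X : M := x%:M - A; pose I1 : M := 1%:M.
have I10 := normr_ge0 I1; have X0 := normr_ge0 X; have B0 := normr_ge0 B.
(* This m bounds the norms of 1, E, X'E and EX, the matrices to which the Lipschitz estimate is
   applied. *)
pose m : R := 1 + (`|I1| + `|B|) * (`|X| + 1) + (`|I1| + `|B|).
have m1 : 1 <= m by rewrite /m -addrA lerDl addr_ge0 ?mulr_ge0 ?addr_ge0.
have [C C0 lipC] := cdet_lipschitz m1.
have IBX0 : 0 <= (`|I1| + `|B|) * (`|X| + 1) by rewrite mulr_ge0 ?addr_ge0.
exists (2 * C * (1 + `|B|)) => [|h A' h1 A'A hC].
  by rewrite !mulr_ge0 ?addr_ge0.
pose X' : M := x%:M - A'; pose E : M := I1 + h *: B.
have nE : `|E| <= `|I1| + `|B|.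
  apply: le_trans (ler_normD _ _) _; rewrite lerD2l normrZ.
  by rewrite ler_piMl.
have XX' : X' = X - (A' - A) by rewrite /X' /X opprB addrA subrK.
have nX' : `|X'| <= `|X| + 1.
  by rewrite XX'; apply: le_trans (ler_normB _ _) _; rewrite lerD2l.
have EX : mul X' E - mul E X =
   h *: bracket B A - (A' - A) - h *: mul (A' - A) B.
  rewrite /E cmulDr cmulDl cmulZl cmulZr [mul X' I1]mulmx1 [mul I1 X]mul1mx.
  have XB : mul X' B - mul B X = bracket B A - mul (A' - A) B.
    have -> : mul X' B = (x *: (B : 'M[R[i]]_d) : M) - mul A' B.
      by rewrite /mul mulmxBl mul_scalar_mx.
    have -> : mul B X = (x *: (B : 'M[R[i]]_d) : M) - mul B A.
      by rewrite /mul mulmxBr mul_mx_scalar.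
    rewrite bracketE cmulDl cmulNl !opprB [RHS]addrA subrK.
    by rewrite [LHS]addrC [LHS]addrA subrK.
  have X'X : X' - X = - (A' - A) by rewrite XX' [LHS]addrAC subrr add0r.
  rewrite opprD addrACA X'X -scalerBr XB scalerBr [LHS]addrA.
  by congr (_ + _); rewrite [LHS]addrC.
have dE : normc (cdet E - 1) <= 2^-1.
  have := lipC E I1; rewrite /I1 cdet1 => /(_ _ _)/le_trans -> //.
  - by apply: le_trans nE _; rewrite /m lerDr addr_ge0.
  - by rewrite /m; lra.
  have -> : E - 1%:M = h *: B by rewrite /E addrC addKr.
  apply: le_trans hC; rewrite normrZ.
  have : 0 <= C * `|h| by rewrite mulr_ge0.
  by have := mulr_ge0 (mulr_ge0 C0 (normr_ge0 h)) B0; lra.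
(* For small h the common factor det E stays away from 0 and can be divided out. *)
have dE2 : 2^-1 <= normc (cdet E).
  have := le_normcD (cdet E - 1) (- cdet E).
  rewrite addrAC subrr add0r !normcN Normc.normc1; lra.
have key : normc (cdet X' - cdet X) * normc (cdet E) <=
    C * (`|A' - A - h *: bracket B A| + `|h| * `|A' - A| * `|B|).
  rewrite -Normc.normcM.
  have -> : (cdet X' - cdet X) * cdet E = cdet (mul X' E) - cdet (mul E X).
    by rewrite !cdetM; ring.
  apply: le_trans (lipC _ _ _ _) _.
  - apply: le_trans (norm_mul _ _) _.
    apply: le_trans (ler_pM _ _ nX' nE) _ => //.
    by rewrite mulrC /m; lra.
  - apply: le_trans (norm_mul _ _) _.
    apply: le_trans (ler_pM _ _ nE (lexx _)) _ => //.
    by rewrite /m mulrDr; lra.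
  rewrite ler_wpM2l // EX; apply: le_trans (ler_normB _ _) _.
  by rewrite distrC lerD2l normrZ -mulrA ler_wpM2l // norm_mul.
rewrite -/X' -/X.
have n0 := normc_ge0 (cdet X' - cdet X).
set r := `|A' - A - _| in key *; have r0 : 0 <= r by exact: normr_ge0.
set q := `|h| * `|A' - A| in key *; have q0 : 0 <= q by rewrite mulr_ge0.
have := ler_wpM2l n0 dE2 => /le_trans/(_ key).
have : C * (r + q * `|B|) <= C * ((1 + `|B|) * (r + q)).
  by rewrite ler_wpM2l //; have := mulr_ge0 B0 r0; lra.
by lra.
Qed.

End CharPoly.

(** * Constancy of the characteristic polynomial along the flow *)

Section Isospectral.
Variables (R : realType) (d : nat).
Local Notation M := (cmat R d).
Local Notation normc := Normc.normc.
Implicit Types (A B X : M).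

Lemma bracketZl (a : R) A B : bracket (a *: A) B = a *: bracket A B.
Proof. by rewrite !bracketE cmulZl cmulZr scalerBr. Qed.

Lemma curve_expansion (u : R -> M) (t : R) (V : M) (e : R) :
  is_derive t 1 u V -> 0 < e ->
  \forall h \near (0 : R)^', `|u (t + h) - u t - h *: V| <= e * `|h|.
Proof.
move=> [du <-] e0.
have /cvgrPdist_le /(_ e e0) nh :
  h^-1 *: ((u \o shift t) (h *: (1 : R^o)) - u t) @[h --> 0^'] --> 'D_1 u t := du.
near=> h.
have h0 : h != 0 by near: h; exact: nbhs_dnbhs_neq.
have : `|'D_1 u t - h^-1 *: (u (h *: (1 : R^o) + t) - u t)| <= e by near: h.
rewrite [_ *: (1 : R^o)]mulr1 distrC [h + t]addrC => hle.
have -> : u (t + h) - u t - h *: 'D_1 u t =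
  h *: (h^-1 *: (u (t + h) - u t) - 'D_1 u t).
  by rewrite scalerBr scalerA mulfV // scale1r.
by rewrite normrZ mulrC ler_wpM2r.
Unshelve. all: by end_near. Qed.

Lemma is_derive0_of_bound (q : R -> R) (t : R) :
  (forall e, 0 < e -> \forall h \near (0 : R)^', `|q (t + h) - q t| <= e * `|h|) ->
  is_derive t 1 q 0.
Proof.
move=> qt.
suff dq : h^-1 *: ((q \o shift t) (h *: (1 : R^o)) - q t) @[h --> 0^'] --> (0 : R).
  by split; [apply/cvg_ex; exists 0|exact: cvg_lim dq].
apply/cvgrPdist_le => e e0; have nh := qt e e0; near=> h.
have h0 : h != 0 by near: h; exact: nbhs_dnbhs_neq.
have qh : `|q (t + h) - q t| <= e * `|h| by near: h.
rewrite /= [_ *: (1 : R^o)]mulr1 [h + t]addrC sub0r normrN normrZ normfV.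
by rewrite mulrC ler_pdivrMr // normr_gt0.
Unshelve. all: by end_near. Qed.

Lemma constant_of_derive0 (q : R -> R) (t : R) :
  (forall s : R, 0 <= s -> is_derive s 1 q 0) -> 0 <= t -> q t = q 0.
Proof.
move=> dq t0; apply/eqP; rewrite eq_le; apply/andP; split.
  by apply: (@decreasing_of_derive _ q (fun=> 0) 0).
rewrite -lerN2; apply: (@decreasing_of_derive _ (- q) (fun=> 0) 0) => // s s0.
have dqs := dq s s0; rewrite -oppr0; exact: is_deriveN.
Qed.

Variable u : R -> M.
Hypothesis du : forall t : R, 0 <= t -> is_derive t 1 u (velocity (u t)).

(** With B = - 4 K the velocity is [B, u], so the bound of [cdet_perturbation] is o(h): det (x - u)
    has derivative zero. *)
Lemma cdet_increment (x : R[i]) (t e : R) : 0 <= t -> 0 < e ->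
  \forall h \near (0 : R)^',
    normc (cdet (x%:M - u (t + h)) - cdet (x%:M - u t)) <= e * `|h|.
Proof.
move=> t0 e0; pose B : M := - (4 *: defect (u t)).
have BV : bracket B (u t) = velocity (u t) by rewrite bracketNl bracketZl.
have [C C0 dC] := cdet_perturbation (u t) B x.
pose e1 := e / (2 * (C + 1)).
have e10 : 0 < e1 by rewrite divr_gt0 // mulr_gt0 // ltr_wpDl.
have nV := normr_ge0 (velocity (u t)).
have nr := curve_expansion (du t0) e10.
(* For |h| <= e2 the increment of u, at most (e1 + |u'|) |h|, stays below both 1 and e1. *)
pose e2 := Num.min 1 e1 / (e1 + `|velocity (u t)|).
have e20 : 0 < e2 by rewrite divr_gt0 ?lt_min ?ltr01 // ltr_wpDr.
have e30 : 0 < 2^-1 / (C + 1) by rewrite divr_gt0 // ltr_wpDl.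
near=> h.
have hr : `|u (t + h) - u t - h *: velocity (u t)| <= e1 * `|h| by near: h.
have h1 : `|h| <= 1 by near: h; exact: dnbhs0_le.
have h2 : `|h| <= e2 by near: h; exact: dnbhs0_le.
have h3 : `|h| <= 2^-1 / (C + 1) by near: h; exact: dnbhs0_le.
have : `|u (t + h) - u t| <= Num.min 1 e1.
  rewrite -(subrK (h *: velocity (u t)) (u (t + h) - u t)).
  apply: le_trans (ler_normD _ _) _; rewrite normrZ.
  apply: le_trans (lerD hr (lexx _)) _; rewrite mulrC -mulrDr.
  by rewrite -ler_pdivlMr // ltr_wpDr.
rewrite le_min => /andP[A1 Ae].
have hC : C * `|h| <= 2^-1.
  apply: le_trans (_ : (C + 1) * `|h| <= _); first by rewrite ler_wpM2r // lerDl.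
  by rewrite mulrC -ler_pdivlMr // ltr_wpDl.
apply: le_trans (dC h _ h1 A1 hC) _; rewrite BV.
have eE : e = 2 * (C + 1) * e1 by rewrite /e1; field; rewrite gt_eqF // ltr_wpDl.
apply: le_trans (_ : C * (e1 * `|h| + `|h| * e1) <= _).
  by rewrite ler_wpM2l // lerD // ler_wpM2l.
have : 0 <= e1 * `|h| by rewrite mulr_ge0 // ltW.
by rewrite eE; lra.
Unshelve. all: by end_near. Qed.

Lemma cdet_constant (x : R[i]) (t : R) : 0 <= t ->
  cdet (x%:M - u t) = cdet (x%:M - u 0).
Proof.
move=> t0.
(* The mean value theorem concerns real functions; [rho] stands for the real or the imaginary
   part. *)
have cst (rho : R[i] -> R) : {morph rho : z w / z - w} ->
    (forall z, `|rho z| <= normc z) ->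
    rho (cdet (x%:M - u t)) = rho (cdet (x%:M - u 0)).
  move=> rhoB rho_le.
  apply: (@constant_of_derive0 (fun s => rho (cdet (x%:M - u s)))) => // s s0.
  apply: is_derive0_of_bound => e e0; have nh := cdet_increment x s0 e0.
  near=> h; rewrite -rhoB; apply: le_trans (rho_le _) _.
  by near: h.
apply/eqP; rewrite eq_complex; apply/andP; split; apply/eqP; apply: cst.
- by case=> a b [a' b'].
- case=> a b /=; rewrite -sqrtr_sqr ler_wsqrtr // lerDl sqr_ge0 //.
- by case=> a b [a' b'].
- case=> a b /=; rewrite -sqrtr_sqr ler_wsqrtr // lerDr sqr_ge0 //.
Unshelve. all: by end_near. Qed.

(** The determinant is Lipschitz on bounded sets, so the constant value of det (x - u) passes to any
    matrix that the flow line approaches arbitrarily closely. *)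
Lemma char_poly_limit (B : M) :
  (forall e : R, 0 < e -> exists2 t : R, 0 <= t & `|u t - B| <= e) ->
  char_poly (B : 'M[R[i]]_d) = char_poly (u 0 : 'M[R[i]]_d).
Proof.
move=> uB; apply: char_poly_eq => x.
pose m := 1 + `|(x%:M : M) - B| + 1.
have m1 : 1 <= m by rewrite /m -addrA lerDl addr_ge0.
have [C C0 lipC] := cdet_lipschitz d m1.
apply/eqP; rewrite -subr_eq0; apply/eqP; apply: Normc.eq0_normc; apply/eqP.
rewrite eq_le normc_ge0 andbT; apply/ler_addgt0Pr => e e0; rewrite add0r.
have e'0 : 0 < Num.min 1 (e / (C + 1)).
  by rewrite lt_min ltr01 divr_gt0 // ltr_wpDl.
have [t t0] := uB _ e'0; rewrite le_min => /andP[u1 ue].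
rewrite -[\det (_ - u 0)]/(cdet (x%:M - u 0)) -(cdet_constant x t0).
have xE : (x%:M : M) - u t = x%:M - B - (u t - B).
  by rewrite (opprB (u t) B) addrA subrK.
apply: le_trans (lipC _ _ _ _) _.
- by rewrite /m; lra.
- rewrite xE; apply: le_trans (ler_normB _ _) _.
  by rewrite /m; lra.
rewrite xE opprB addrC subrK.
apply: le_trans (_ : (C + 1) * `|u t - B| <= _); first by rewrite ler_wpM2r // lerDl.
by rewrite mulrC -ler_pdivlMr // ltr_wpDl.
Qed.

Lemma char_poly_constant (t : R) : 0 <= t ->
  char_poly (u t : 'M[R[i]]_d) = char_poly (u 0 : 'M[R[i]]_d).
Proof. by move=> t0; apply: char_poly_eq => x; exact: cdet_constant. Qed.

End Isospectral.

(** * Convergence *)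

Section Convergence.
Variables (R : realType) (d : nat).
Local Notation M := (cmat R d).
Local Notation normc := Normc.normc.
Implicit Types (A B U X : M).

Lemma norm_le_re_im (e : R) X : 0 <= e ->
  (forall i j, `|complex.Re (X i j)| <= e /\ `|complex.Im (X i j)| <= e) ->
  `|X| <= 2 * d%:R * e.
Proof.
move=> e0 Xe; rewrite -(@ler_pXn2r _ 2) ?nnegrE ?mulr_ge0 //.
rewrite sqr_norm_entries.
have : \sum_i \sum_j normc (X i j) ^+ 2 <=
    \sum_(i < d) \sum_(j < d) (2 * e ^+ 2).
  apply: ler_sum => i _; apply: ler_sum => j _; have [re im] := Xe i j.
  have sq (a : R) : `|a| <= e -> a ^+ 2 <= e ^+ 2.
    by move=> ae; rewrite -real_normK ?num_real // lerXn2r ?nnegrE.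
  by rewrite normcE mulr_natl mulr2n lerD // sq.
move=> /le_trans -> //; rewrite !sumr_const !card_ord.
rewrite -[_ *+ d *+ d]mulr_natr -[_ *+ d]mulr_natr.
have : 0 <= 2 * e ^+ 2 * d%:R * d%:R by rewrite !mulr_ge0 ?sqr_ge0.
by rewrite !expr2; lra.
Qed.

Lemma re_inner A i j : complex.Re (A i j) = inner A (delta_mx i j : M).
Proof.
rewrite innerE (bigD1 i) //= [X in _ + X]big1 => [|k ki]; last first.
  by rewrite big1 // => l _; rewrite mxE (negbTE ki) /= !mulr0 addr0.
rewrite (bigD1 j) //= big1 => [|l lj]; last first.
  by rewrite mxE eqxx (negbTE lj) /= !mulr0 addr0.
by rewrite mxE !eqxx /= mulr1 mulr0 !addr0.
Qed.

Lemma im_inner A i j :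
  complex.Im (A i j) = inner A ('i%C *: (delta_mx i j : 'M[R[i]]_d) : M).
Proof.
rewrite innerE (bigD1 i) //= [X in _ + X]big1 => [|k ki]; last first.
  by rewrite big1 // => l _; rewrite !mxE (negbTE ki) mulr0 /= !mulr0 addr0.
rewrite (bigD1 j) //= big1 => [|l lj]; last first.
  by rewrite !mxE eqxx (negbTE lj) mulr0 /= !mulr0 addr0.
by rewrite !mxE !eqxx mulr1 /= mulr1 mulr0 add0r !addr0.
Qed.

(** The real coordinates of u are its pairings with the matrices E_ij and i E_ij, finitely many in
    number. *)
Lemma weak_cvg (u : R -> M) :
  (forall U, exists l : R, inner (u t) U @[t --> +oo] --> l) ->
  exists B, u t @[t --> +oo] --> B.
Proof.
move=> uU.
have /choice[re reP] : forall ij : 'I_d * 'I_d, exists l : R,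
    complex.Re (u t ij.1 ij.2) @[t --> +oo] --> l.
  move=> [i j] /=; have [l ul] := uU (delta_mx i j : M); exists l.
  by apply: cvg_trans ul; apply: near_eq_cvg; near=> t; rewrite re_inner.
have /choice[im imP] : forall ij : 'I_d * 'I_d, exists l : R,
    complex.Im (u t ij.1 ij.2) @[t --> +oo] --> l.
  move=> [i j] /=.
  have [l ul] := uU ('i%C *: (delta_mx i j : 'M[R[i]]_d) : M); exists l.
  by apply: cvg_trans ul; apply: near_eq_cvg; near=> t; rewrite im_inner.
exists (\matrix_(i, j) (re (i, j) +i* im (i, j))%C : M).
apply/cvgrPdist_le => e e0; set B := (\matrix_(i, j) _ : M).
pose e' := e / (2 * d%:R + 1).
have d0 : 0 < 2 * d%:R + 1 :> R by rewrite ltr_wpDl // mulr_ge0.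
have e'0 : 0 < e' by rewrite divr_gt0.
have nre : \forall t \near +oo, forall ij : 'I_d * 'I_d,
    `|re ij - complex.Re (u t ij.1 ij.2)| <= e'.
  by apply: filter_forall => ij; have /cvgrPdist_le := reP ij; exact.
have nim : \forall t \near +oo, forall ij : 'I_d * 'I_d,
    `|im ij - complex.Im (u t ij.1 ij.2)| <= e'.
  by apply: filter_forall => ij; have /cvgrPdist_le := imP ij; exact.
near=> t.
have rt : forall ij : 'I_d * 'I_d, `|re ij - complex.Re (u t ij.1 ij.2)| <= e'.
  by near: t.
have it : forall ij : 'I_d * 'I_d, `|im ij - complex.Im (u t ij.1 ij.2)| <= e'.
  by near: t.
apply: le_trans (_ : 2 * d%:R * e' <= _).
  apply: norm_le_re_im => [|i j]; first exact: ltW.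
  have := rt (i, j); have := it (i, j).
  by rewrite addE oppE mxE /=; case: (u t i j).
rewrite /e' mulrA ler_pdivrMr // mulrC ler_wpM2l ?(ltW e0) //.
by rewrite lerDl.
Unshelve. all: by end_near. Qed.

Variable u : R -> M.
Hypothesis du : forall t : R, 0 <= t -> is_derive t 1 u (velocity (u t)).
Hypothesis d0 : (0 < d)%N.

Lemma derive_inner (U : M) (t : R) : 0 <= t ->
  is_derive t 1 (fun t : R => inner (u t) U) (inner (velocity (u t)) U).
Proof.
move=> t0; have [dN dNE] : differentiable (fun X : M => inner X U) (u t) /\
    forall H, 'd (fun X : M => inner X U) (u t) H = inner U H.
  apply: (@diff_quadratic R d _ _ _ 0) => // H _.
  by rewrite innerDl [inner _ _ + inner H _]addrC addrK innerC subrr normr0 mul0r.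
by have := is_derive_comp_curve (du t0) dN dNE; rewrite innerC.
Qed.

Lemma spectrum_exists A : exists l : d.-tuple R[i], eigenvalues_of A l.
Proof.
have [r] := closed_field_poly_normal (char_poly (A : 'M[R[i]]_d)).
rewrite (monicP (char_poly_monic _)) scale1r => Ar.
have sr : size r == d.
  by have := size_char_poly (A : 'M[R[i]]_d); rewrite Ar size_prod_XsubC => -[->].
by exists (Tuple sr); rewrite /eigenvalues_of Ar (big_tuple _ _ (Tuple sr)).
Qed.

(* The Lojasiewicz inequality turns |u'| into the decay rate of E^(1/4), which
   therefore controls the oscillation of every linear functional of u. *)
Lemma lyapunov_function : exists a C : R, exists s : R -> R,
  [/\ 0 <= a, 0 <= C, forall t, a <= t -> 0 <= s t &
   forall U x y, a <= x -> x <= y ->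
     inner (u y) U + C * `|U| * s y <= inner (u x) U + C * `|U| * s x].
Proof.
have [l ul] := spectrum_exists (u 0).
have [e [C [e0 C0 loj]]] := lojasiewicz l d0 (normr_ge0 (u 0)).
have [a [a0 aE]] := energy_small du (exprn_gt0 2 e0).
have ate (t : R) : a <= t -> `|defect (u t)| <= e.
  by move=> at_; rewrite -(@ler_pXn2r _ 2) ?nnegrE ?(ltW e0) // -energyE aE.
have lojt (t : R) : a <= t ->
    Num.sqrt `|defect (u t)| ^+ 3 <= C * `|bracket (defect (u t)) (u t)|.
  move=> at_; have t0 := le_trans a0 at_.
  apply: loj; [|exact: norm_decreasing|exact: ate].
  by rewrite /eigenvalues_of char_poly_constant.
(* The fourth root of E is not differentiable where E = 0. If E vanishes at some time, it vanishes
   from then on, u is stationary, and s = 0 serves. *)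
have [[t0 at0 Et0]|nE] := pselect (exists2 t : R, a <= t & energy (u t) = 0).
  exists t0, 0, (fun=> 0); split; [exact: le_trans at0|exact: lexx|by []|move=> U x y].
  rewrite !mulr0 !addr0.
  have Ez (s : R) : t0 <= s -> velocity (u s) = 0.
    move=> ts; have : energy (u s) <= 0.
      by rewrite -Et0 (energy_decreasing du) // (le_trans a0).
    rewrite energyE => Es.
    have K0 : `|defect (u s)| = 0.
      by apply/eqP; rewrite -sqrf_eq0 eq_le Es sqr_ge0.
    have := norm_bracket (defect (u s)) (u s).
    rewrite K0 mulr0 mul0r normr_le0 => /eqP G0.
    by rewrite /velocity G0 scaler0 oppr0.
  apply: (@decreasing_of_derive _ (fun t => inner (u t) U) (fun=> 0)) => // s ts.
  have := derive_inner U (le_trans a0 (le_trans at0 ts)).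
  by rewrite Ez // -(subrr U) innerDl innerNl subrr.
(* Here s = E^(1/4) = |K|^(1/2), so s^3 is the left side of the Lojasiewicz inequality. *)
pose s (t : R) := Num.sqrt (Num.sqrt (energy (u t))).
exists a, C, s; split; [exact: a0|exact: C0|by move=> t _; exact: sqrtr_ge0|].
move=> U.
have sE (t : R) : s t = Num.sqrt `|defect (u t)|.
  by rewrite /s energyE sqrtr_sqr ger0_norm.
(* With g = |[K, A]|, the chain rule gives s' = - 16 g^2 / (4 s^3). *)
pose w (t : R) := inner (velocity (u t)) U -
  C * `|U| * (4 * `|bracket (defect (u t)) (u t)| ^+ 2 / s t ^+ 3).
have Epos (t : R) : a <= t -> 0 < energy (u t).
  move=> at_; rewrite lt_def {2}energyE sqr_ge0 andbT.
  by apply/eqP => E0; apply: nE; exists t.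
have spos (t : R) : a <= t -> 0 < s t by move=> at_; rewrite !sqrtr_gt0 Epos.
apply: (@decreasing_of_derive _ (fun t => inner (u t) U + C * `|U| * s t) w).
- move=> t at_; have t0 := le_trans a0 at_.
  have d1 := derive_inner U t0; have d2 := derive_energy du t0.
  have Ep := Epos t at_; have sp := spos t at_.
  have Sp : 0 < Num.sqrt (energy (u t)) by rewrite sqrtr_gt0.
  have d3 := @is_derive1_comp R Num.sqrt (fun t => energy (u t)) t _ _
    (is_derive1_sqrt Ep) d2.
  have d4 := @is_derive1_comp R Num.sqrt _ t _ _ (is_derive1_sqrt Sp) d3.
  apply: (is_derive_eq (is_deriveD d1 (is_deriveZ (C * `|U|) d4))).
  have S2 : Num.sqrt (energy (u t)) = s t ^+ 2 by rewrite sqr_sqrtr ?ltW.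
  rewrite -/(s t) S2 /GRing.scale /= /w; congr (_ + _).
  by move: sp; move: (`|bracket _ _|) (`|U|) (s t) => g v x x0; field; lra.
- move=> t at_; rewrite subr_le0; apply: le_trans (inner_le_norm _ _) _.
  rewrite norm_velocity; have := lojt t at_; rewrite -sE.
  set g := `|bracket _ _|; have g0 : 0 <= g by exact: normr_ge0.
  have s3 : 0 < s t ^+ 3 by rewrite exprn_gt0 // spos.
  move=> sg; have U0 := normr_ge0 U.
  (* From s^3 <= C g follows |u'| = 4 g <= 4 C g^2 / s^3 = - C s'. *)
  rewrite [leRHS]mulrAC ler_wpM2r // mulrA ler_pdivlMr //.
  have := ler_wpM2r g0 sg; rewrite !expr2; lra.
Qed.

(** The monotone quantities for U and - U share the term C |U| s, so half the difference of their
    limits is the limit of <u, U>. *)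
Lemma flow_cvg : exists B, u t @[t --> +oo] --> B.
Proof.
have [a [C [s [a0 C0 s0 dec]]]] := lyapunov_function.
apply: weak_cvg => U.
have lb V (t : R) : a <= t -> - (`|u 0| * `|V|) <= inner (u t) V + C * `|V| * s t.
  move=> at_; have : `|inner (u t) V| <= `|u 0| * `|V|.
    apply: le_trans (inner_norm _ _) _; rewrite ler_wpM2r //.
    by rewrite (norm_decreasing du) // (le_trans a0).
  rewrite ler_norml => /andP[+ _] => /le_trans -> //.
  by rewrite lerDl !mulr_ge0 ?s0.
have [l1 h1] := decreasing_cvg (dec U) (lb U).
have [l2 h2] := decreasing_cvg (dec (- U)) (lb (- U)).
exists (2^-1 * (l1 - l2)).
have : 2^-1 * ((inner (u t) U + C * `|U| * s t) -
    (inner (u t) (- U) + C * `|- U| * s t)) @[t --> +oo] --> 2^-1 * (l1 - l2).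
  by apply: cvgMr; exact: cvgB h1 h2.
apply: cvg_trans; apply: near_eq_cvg; near=> t.
by rewrite normrN innerNr; field.
Unshelve. all: by end_near. Qed.

(** E(u) tends to E(B) by continuity and to 0 by the decay estimate. *)
Lemma flow_limit_normal B : u t @[t --> +oo] --> B -> defect B = 0.
Proof.
move=> uB; have [dE _] := diff_energy B.
have cE : energy (u t) @[t --> +oo] --> energy B.
  by apply: cvg_comp uB _; exact: differentiable_continuous dE.
have c0 : energy (u t) @[t --> +oo] --> (0 : R).
  apply/cvgrPdist_le => e e0; have [a [a0 aE]] := energy_small du e0.
  near=> t.
  have at_ : a <= t.
    by near: t; apply: nbhs_pinfty_ge; exact: num_real.
  by rewrite sub0r normrN energyE ger0_norm ?sqr_ge0 // -energyE aE.
have : energy B = 0 by exact: (cvg_unique _ cE c0).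
by rewrite energyE => /eqP; rewrite sqrf_eq0 normr_eq0 => /eqP.
Unshelve. all: by end_near. Qed.

End Convergence.

Unset Implicit Arguments.

Theorem theorem2p6 (R : realType) (d : nat) (hd : (1 <= d)%N)
    (F : cmat R d -> R -> cmat R d)
    (hF : is_negative_gradient_flow (@energy R d) F)
    (A0 : cmat R d) :
  exists A_oo : cmat R d,
    [/\ F A0 t @[t --> +oo] --> A_oo,
        A_oo \is normalmx,
        exists lambda : d.-tuple R[i],
          eigenvalues_of A0 lambda /\ eigenvalues_of A_oo lambda &
        (forall i j, complex.Im (A0 i j) = 0) ->
        forall i j, complex.Im (A_oo i j) = 0].
Proof.
have [u [uF du0]] := flow_line A0 hF.
have du (t : R) : 0 <= t -> is_derive t 1 u (velocity (u t)).
  by move=> t0; have := du0 t t0; rewrite gradient_energy.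
have u0 : u 0 = A0 by rewrite uF //; have [] := hF A0.
have [B uB] := flow_cvg du hd.
have uBe (e : R) : 0 < e -> exists2 t : R, 0 <= t & `|u t - B| <= e.
  move=> e0; have /cvgrPdist_le/(_ e e0) ue := uB.
  near (pinfty_nbhs R) => t; exists t; first by near: t; exact: nbhs_pinfty_ge.
  by rewrite distrC; near: t.
exists B; split.
- apply: cvg_trans uB; apply: near_eq_cvg; near=> t.
  by rewrite uF //; near: t; exact: nbhs_pinfty_ge.
- have := flow_limit_normal du uB; rewrite /defect bracketE => /eqP.
  by rewrite subr_eq0.
- have [l Al] := spectrum_exists A0; exists l; split=> //.
  by rewrite /eigenvalues_of (char_poly_limit du uBe) u0.
move=> imA i j.
have uc : u 0 = cconj (u 0).
  apply/matrixP => k m; rewrite u0 cconjE; have := imA k m.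
  by case: (A0 k m) => x y /= ->; rewrite oppr0.
have imu (t : R) : 0 <= t -> complex.Im (u t i j) = 0.
  move=> t0; have := flow_real du uc t0 => /matrixP/(_ i j).
  rewrite cconjE; case: (u t i j) => x y [] /eqP.
  by rewrite -subr_eq0 opprK -mulr2n mulrn_eq0 => /eqP.
(* The imaginary part of an entry of B is at most |u t - B| in modulus, as that of u t is zero. *)
apply/eqP; rewrite -normr_le0; apply/ler_addgt0Pr => e e0; rewrite add0r.
have [t t0 /(le_trans (entry_le_norm _ i j))] := uBe e e0.
apply: le_trans; rewrite addE oppE.
have := imu t t0; case: (u t i j) => x y /= ->.
case: (B i j) => z w /=; rewrite -[`|w|]sqrtr_sqr ler_wsqrtr //.
by rewrite sub0r sqrrN lerDr sqr_ge0.
Unshelve. all: by end_near. Qed.
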